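(* Let $E$ be a Banach space. There exists a unique injective and contractive lattice-algebra homomorphism \[ \iota_E\colon \mathrm{FNfA}[E]\to C(B_{E^*}) \] satisfying $(\iota_E\eta_x)(x^* )=x^*(x)$ for all $x\in E$ and $x^*\in B_{E^*}$.
   Context: All spaces are real. A vector lattice algebra is a real associative algebra that is also a vector lattice in which the product of positive elements is positive. An $f$-algebra is a vector lattice algebra such that $a\wedge b=0$ and $c\ge 0$ imply $(ac)\wedge b=0=(ca)\wedge b$. A normed $f$-algebra is an $f$-algebra equipped with a submultiplicative lattice norm. A lattice-algebra homomorphism is a linear map preserving the lattice operations and the product. Contractive means of operator norm at most $1$. The free normed $f$-algebra generated by $E$ is a normed $f$-algebra $\mathrm{FNfA}[E]$ together with a linear isometric embedding $\eta_E\colon E\to\mathrm{FNfA}[E]$ (write $\eta_x=\eta_E(x)$) such that for every normed $f$-algebra $A$ and every contractive operator $T\colon E\to A$ there exists a unique lattice-algebra homomorphism $\hat T\colon\mathrm{FNfA}[E]\to A$ satisfying $\hat T\circ\eta_E=T$ and $\|\hat T\|=\|T\|$. It exists and is unique up to isometric lattice-algebra isomorphism; it is generated as a vector lattice algebra by $\{\eta_x : x\in E\}$. $B_{E^*}$ is the closed unit ball of $E^*$ with the weak$^*$ topology, and $C(B_{E^*})$ is the space of real weak$^*$-continuous functions on it with the supremum norm and pointwise order and product. *)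

(* Defs.v *)
From HB Require Import structures.
From mathcomp Require Import all_boot all_order all_algebra.
From mathcomp Require Import all_classical all_reals all_analysis.

Set Implicit Arguments.
Unset Strict Implicit.
Unset Printing Implicit Defensive.

Import Order.TTheory GRing.Theory Num.Theory.
Import numFieldNormedType.Exports.

Local Open Scope classical_set_scope.
Local Open Scope ring_scope.

(* A join of the ordered structures of the library with [normedModType] would
   have to be inserted below [numDomainType], so that the order and the lattice
   operations are provided here by a mixin over [lmodType]. *)
HB.mixin Record Lmodule_isVectorLattice (R : realType) V
    & GRing.Lmodule R V := {
  vle : V -> V -> Prop;
  vmeet : V -> V -> V;
  vjoin : V -> V -> V;
  vle_refl : forall x, vle x x;
  vle_anti : forall x y, vle x y -> vle y x -> x = y;
  vle_trans : forall y x z, vle x y -> vle y z -> vle x z;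
  vle_meet : forall x y z, vle x (vmeet y z) <-> vle x y /\ vle x z;
  vjoin_le : forall x y z, vle (vjoin x y) z <-> vle x z /\ vle y z;
  vleD2r : forall x y z, vle x y -> vle (x + z) (y + z);
  vscale_ge0 : forall (a : R) x, 0 <= a -> vle 0 x -> vle 0 (a *: x)
}.

#[short(type="vectorLatticeType")]
HB.structure Definition VectorLattice (R : realType) :=
  {V of GRing.Lmodule R V & Lmodule_isVectorLattice R V}.

(* No unit is assumed, so that the ring structures of the library do not
   apply. *)
HB.mixin Record VectorLattice_isAlgebra (R : realType) V
    & VectorLattice R V := {
  amul : V -> V -> V;
  amulA : associative amul;
  amulDl : left_distributive amul +%R;
  amulDr : right_distributive amul +%R;
  amulZl : forall (a : R) x y, amul (a *: x) y = a *: amul x y;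
  amulZr : forall (a : R) x y, amul x (a *: y) = a *: amul x y;
  amul_ge0 : forall x y : V, vle 0 x -> vle 0 y -> vle 0 (amul x y)
}.

#[short(type="vectorLatticeAlgType")]
HB.structure Definition VectorLatticeAlgebra (R : realType) :=
  {V of VectorLattice R V & VectorLattice_isAlgebra R V}.

HB.mixin Record VectorLatticeAlgebra_isFAlgebra (R : realType) V
    & VectorLatticeAlgebra R V := {
  famulP : forall a b c : V, vmeet a b = 0 -> vle 0 c ->
    vmeet (amul a c) b = 0 /\ vmeet (amul c a) b = 0
}.

#[short(type="fAlgType")]
HB.structure Definition FAlgebra (R : realType) :=
  {V of VectorLatticeAlgebra R V & VectorLatticeAlgebra_isFAlgebra R V}.

Definition vabs (R : realType) (V : vectorLatticeType R) (x : V) : V :=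
  vjoin x (- x).

HB.mixin Record FAlgebra_isNormedFAlgebra (R : realType) V
    & FAlgebra R V & NormedModule R V := {
  lattice_norm : forall x y : V, vle (vabs x) (vabs y) -> `|x| <= `|y| :> R;
  normM_le : forall x y : V, `|amul x y| <= `|x| * `|y| :> R
}.

#[short(type="normedFAlgType")]
HB.structure Definition NormedFAlgebra (R : realType) :=
  {V of FAlgebra R V & NormedModule R V & FAlgebra_isNormedFAlgebra R V}.

Definition lattice_alg_hom (R : realType) (A B : vectorLatticeAlgType R)
    (h : A -> B) : Prop :=
  [/\ linear h,
      {morph h : x y / vmeet x y},
      {morph h : x y / vjoin x y} &
      {morph h : x y / amul x y}].

(* [+oo] for an unbounded map *)
Definition opnorm (R : realType) (V W : normedModType R) (f : V -> W)
    : \bar R :=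
  ereal_sup [set (`|f x|)%:E | x in [set x : V | `|x| <= 1]].

Definition contractive (R : realType) (V W : normedModType R) (f : V -> W) :=
  (opnorm f <= 1)%E.

(* [F], with the embedding [eta], is a free normed f-algebra generated by [E].
   The extension [That] of [T] is unique among all the lattice-algebra
   homomorphisms extending [T], whatever their norm. *)
Record is_FNfA (R : realType) (E : normedModType R) (F : normedFAlgType R)
    (eta : {linear E -> F}) : Prop := {
  FNfA_isometry : forall x, `|eta x| = `|x|;
  FNfA_universal : forall (A : normedFAlgType R) (T : {linear E -> A}),
    contractive T ->
    exists That : F -> A,
      [/\ lattice_alg_hom That, That \o eta = T, opnorm That = opnorm T &
          forall h : F -> A, lattice_alg_hom h -> h \o eta = T -> h = That]
}.

(* The topology is that of pointwise convergence on [E], induced on the ball;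
   elements of the type [dual_ball E] are points of the closed unit ball. *)
Definition dual_ball (R : realType) (E : normedModType R) : set {ptws E -> R} :=
  [set f | [/\ linear (f : E -> R^o), continuous (f : E -> R^o) &
               (opnorm (f : E -> R^o) <= 1)%E]].

Arguments dual_ball {R} E _.

(* [cK] makes the supremum norm finite. The alias keeps the norm topology apart
   from the topologies that the library puts on [continuousType]. *)
Definition contfun (R : realType) (K : topologicalType)
  (cK : compact [set: K]) : Type := continuousType K R.
Arguments contfun R {K} cK.

Section contfun_instances.
Variables (R : realType) (K : topologicalType) (cK : compact [set: K]).

Local Notation CK := (contfun R cK).
Implicit Types (f g h : CK) (x : K).

Definition mkcontfun (u : K -> R) (cu : continuous u) : CK :=
  HB.pack u (isContinuous.Build K R u cu).

Lemma contfun_eq f g : (forall x, f x = g x) -> f = g.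
Proof. by move=> fg; apply/continuousEP. Qed.

Let cfunC f : continuous (f : K -> R).
Proof. exact: cts_fun. Qed.

Let zeroC : continuous (cst 0 : K -> R).
Proof. by move=> x; exact: cvg_cst. Qed.
Let oppC f : continuous (fun x => - f x).
Proof. by move=> x; apply: cvgN; exact: cfunC. Qed.
Let addC f g : continuous (fun x => f x + g x).
Proof. by move=> x; apply: cvgD; exact: cfunC. Qed.
Let scaleC (a : R) f : continuous (fun x => a * f x).
Proof. by move=> x; apply: cvgM; [exact: cvg_cst|exact: cfunC]. Qed.
Let mulC f g : continuous (fun x => f x * g x).
Proof. by move=> x; apply: cvgM; exact: cfunC. Qed.
Let minC f g : continuous (fun x => Num.min (f x) (g x)).
Proof. by move=> x; apply: (@continuous_min R K f g x); exact: cfunC. Qed.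
Let maxC f g : continuous (fun x => Num.max (f x) (g x)).
Proof. by move=> x; apply: (@continuous_max R K f g x); exact: cfunC. Qed.

HB.instance Definition _ := Choice.copy CK (continuousType K R).

Let addA : associative (fun f g => mkcontfun (@addC f g)).
Proof. by move=> f g h; apply: contfun_eq => x /=; rewrite addrA. Qed.
Let addCm : commutative (fun f g => mkcontfun (@addC f g)).
Proof. by move=> f g; apply: contfun_eq => x /=; rewrite addrC. Qed.
Let add0 : left_id (mkcontfun zeroC) (fun f g => mkcontfun (@addC f g)).
Proof. by move=> f; apply: contfun_eq => x /=; rewrite add0r. Qed.
Let addN : left_inverse (mkcontfun zeroC) (fun f => mkcontfun (@oppC f))
  (fun f g => mkcontfun (@addC f g)).
Proof. by move=> f; apply: contfun_eq => x /=; rewrite addNr. Qed.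

HB.instance Definition _ := GRing.isZmodule.Build CK addA addCm add0 addN.

Let scaleA (a b : R) f :
  mkcontfun (@scaleC a (mkcontfun (@scaleC b f))) =
  mkcontfun (@scaleC (a * b) f).
Proof. by apply: contfun_eq => x /=; rewrite mulrA. Qed.
Let scale1 : left_id 1 (fun a f => mkcontfun (@scaleC a f)).
Proof. by move=> f; apply: contfun_eq => x /=; rewrite mul1r. Qed.
Let scaleDr : right_distributive (fun a f => mkcontfun (@scaleC a f)) +%R.
Proof. by move=> a f g; apply: contfun_eq => x /=; rewrite mulrDr. Qed.
Let scaleDl f : {morph (fun a => mkcontfun (@scaleC a f)) : a b / a + b}.
Proof. by move=> a b; apply: contfun_eq => x /=; rewrite mulrDl. Qed.

HB.instance Definition _ :=
  GRing.Zmodule_isLmodule.Build R CK scaleA scale1 scaleDr scaleDl.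

Definition contfun_le f g : Prop := forall x, f x <= g x.

Let cle_refl f : contfun_le f f. Proof. by move=> x. Qed.
Let cle_anti f g : contfun_le f g -> contfun_le g f -> f = g.
Proof.
by move=> fg gf; apply: contfun_eq => x; apply/eqP; rewrite eq_le fg gf.
Qed.
Let cle_trans g f h : contfun_le f g -> contfun_le g h -> contfun_le f h.
Proof. by move=> fg gh x; exact: le_trans (fg x) (gh x). Qed.
Let cle_meet f g h :
  contfun_le f (mkcontfun (@minC g h)) <-> contfun_le f g /\ contfun_le f h.
Proof.
split=> [H|[fg fh] x /=]; last by rewrite le_min fg fh.
by split=> x; move: (H x); rewrite /= le_min => /andP[].
Qed.
Let join_le f g h :
  contfun_le (mkcontfun (@maxC f g)) h <-> contfun_le f h /\ contfun_le g h.
Proof.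
split=> [H|[fg fh] x /=]; last by rewrite ge_max fg fh.
by split=> x; move: (H x); rewrite /= ge_max => /andP[].
Qed.
Let leD f g h : contfun_le f g -> contfun_le (f + h) (g + h).
Proof. by move=> fg x; rewrite lerD2r; exact: fg. Qed.
Let scale_ge0 (a : R) f : 0 <= a -> contfun_le 0 f -> contfun_le 0 (a *: f).
Proof. by move=> a0 f0 x; apply: mulr_ge0 => //; exact: f0. Qed.

HB.instance Definition _ := Lmodule_isVectorLattice.Build R CK
  cle_refl cle_anti cle_trans cle_meet join_le leD scale_ge0.

Let mulA : associative (fun f g => mkcontfun (@mulC f g)).
Proof. by move=> f g h; apply: contfun_eq => x /=; rewrite mulrA. Qed.
Let mulDl : left_distributive (fun f g => mkcontfun (@mulC f g)) +%R.
Proof. by move=> f g h; apply: contfun_eq => x /=; rewrite mulrDl. Qed.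
Let mulDr : right_distributive (fun f g => mkcontfun (@mulC f g)) +%R.
Proof. by move=> f g h; apply: contfun_eq => x /=; rewrite mulrDr. Qed.
Let mulZl (a : R) f g :
  mkcontfun (@mulC (a *: f) g) = a *: mkcontfun (@mulC f g).
Proof. by apply: contfun_eq => x /=; rewrite mulrA. Qed.
Let mulZr (a : R) f g :
  mkcontfun (@mulC f (a *: g)) = a *: mkcontfun (@mulC f g).
Proof. by apply: contfun_eq => x /=; rewrite mulrCA. Qed.
Let mul_ge0 f g : vle 0 f -> vle 0 g -> vle 0 (mkcontfun (@mulC f g)).
Proof.
by move=> f0 g0 x; apply: mulr_ge0; [exact: f0|exact: g0].
Qed.

HB.instance Definition _ := VectorLattice_isAlgebra.Build R CK
  mulA mulDl mulDr mulZl mulZr mul_ge0.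

Let fmul f g h : vmeet f g = 0 -> vle 0 h ->
  vmeet (amul f h) g = 0 /\ vmeet (amul h f) g = 0.
Proof.
move=> fg h0.
suff H x : Num.min (f x * h x) (g x) = 0.
  split; apply: contfun_eq => x; first exact: H.
  by rewrite -[RHS](H x) /= mulrC.
have : Num.min (f x) (g x) = 0 by have /(congr1 (fun u : CK => u x)) := fg.
have : 0 <= h x by exact: h0.
move: (f x) (g x) (h x) => a b c c0.
case: (leP a b) => ab e0; rewrite e0 in ab *; first by rewrite mul0r min_l.
by rewrite min_r // mulr_ge0 // ltW.
Qed.

HB.instance Definition _ := VectorLatticeAlgebra_isFAlgebra.Build R CK fmul.

Definition sup_norm f : R := sup [set `|f x| | x in [set: K]].

Let has_ubound_norm f : has_ubound [set `|f x| | x in [set: K]].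
Proof.
have cf : compact [set (f : K -> R) x | x in [set: K]].
  by apply: continuous_compact => //; apply: continuous_subspaceT; exact: cfunC.
have [M [_ HM]] := @compact_bounded R R^o _ cf.
exists (M + 1) => _ [x _ <-]; apply: (HM (M + 1)); first by rewrite ltrDl.
by exists x.
Qed.

Lemma sup_norm_ub f x : `|f x| <= sup_norm f.
Proof. by apply: ub_le_sup; [exact: has_ubound_norm|exists x]. Qed.

Lemma sup_norm_le f (M : R) : 0 <= M -> (forall x, `|f x| <= M) ->
  sup_norm f <= M.
Proof.
move=> M0 fM; rewrite /sup_norm.
have [->|/set0P ne] := eqVneq [set `|f x| | x in [set: K]] set0.
  by rewrite sup0.
by apply: ge_sup => // _ [x _ <-].
Qed.

Lemma sup_norm_ge0 f : 0 <= sup_norm f.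
Proof.
rewrite /sup_norm.
have [->|/set0P[_ [x _ _]]] := eqVneq [set `|f x| | x in [set: K]] set0.
  by rewrite sup0.
exact: le_trans (normr_ge0 (f x)) (sup_norm_ub f x).
Qed.

Let normD f g : sup_norm (f + g) <= sup_norm f + sup_norm g.
Proof.
apply: sup_norm_le => [|x]; first by rewrite addr_ge0 // sup_norm_ge0.
by apply: le_trans (ler_normD _ _) _; rewrite lerD // sup_norm_ub.
Qed.
Let normZ_le (a : R) f : sup_norm (a *: f) <= `|a| * sup_norm f.
Proof.
apply: sup_norm_le => [|x]; first by rewrite mulr_ge0 // sup_norm_ge0.
by rewrite normrM ler_wpM2l // sup_norm_ub.
Qed.
Let normZ (a : R) f : sup_norm (a *: f) = `|a| * sup_norm f.
Proof.
apply/eqP; rewrite eq_le normZ_le /=.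
have [->|a0] := eqVneq a 0; first by rewrite normr0 mul0r sup_norm_ge0.
have := normZ_le a^-1 (a *: f).
by rewrite scalerA mulVf // scale1r normfV ler_pdivlMl // normr_gt0.
Qed.
Let norm_eq0 f : sup_norm f = 0 -> f = 0.
Proof.
move=> f0; apply: contfun_eq => x; apply/eqP; rewrite -normr_le0 -f0.
exact: sup_norm_ub.
Qed.

HB.instance Definition _ :=
  Lmodule_isNormed.Build R CK normD normZ norm_eq0.

Let vabsE f x : (vabs f : CK) x = `|f x|.
Proof. by rewrite -maxrN. Qed.

Let norm_lattice f g : vle (vabs f) (vabs g) -> `|f| <= `|g| :> R.
Proof.
move=> fg; apply: sup_norm_le => [|x]; first exact: sup_norm_ge0.
by apply: le_trans (sup_norm_ub g x); have := fg x; rewrite !vabsE.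
Qed.
Let norm_mul f g : `|amul f g| <= `|f| * `|g| :> R.
Proof.
apply: sup_norm_le => [|x]; first by rewrite mulr_ge0 // sup_norm_ge0.
by rewrite normrM ler_pM // sup_norm_ub.
Qed.

HB.instance Definition _ :=
  FAlgebra_isNormedFAlgebra.Build R CK norm_lattice norm_mul.

End contfun_instances.

Section dual_ball_compact.
Variables (R : realType) (E : normedModType R).

Lemma opnorm_ub1 (f : E -> R^o) : linear f -> (opnorm f <= 1)%E ->
  forall x, `|f x| <= `|x|.
Proof.
move=> lf f1 x; pose g : {linear E -> R^o} :=
  HB.pack f (GRing.isLinear.Build R E R^o *:%R f lf).
have fZ a y : f (a *: y) = a * f y by exact: (linearZ_LR g).
have [->|x0] := eqVneq x 0.
  by rewrite -(scale0r 0) fZ mul0r !normr0 normr_ge0.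
have nx : 0 < `|x| by rewrite normr_gt0.
have : (`|f (`|x|^-1 *: x)|%:E <= 1)%E.
  apply: le_trans f1; apply: ereal_sup_ubound; exists (`|x|^-1 *: x) => //=.
  by rewrite normrZ normfV normr_id mulVf // gt_eqF.
rewrite lee_fin fZ normrM normfV normr_id.
by rewrite ler_pdivrMl // mulr1.
Qed.

Lemma dual_ballP (f : E -> R^o) :
  dual_ball E f <-> linear f /\ forall x, `|f x| <= `|x|.
Proof.
split=> [[lf _ f1]|[lf fx]]; first by split=> //; exact: opnorm_ub1.
split=> //.
  pose g : {linear E -> R^o} :=
    HB.pack f (GRing.isLinear.Build R E R^o *:%R f lf).
  apply: (@bounded_linear_continuous R E R^o g).
  by apply/linear_boundedP; near=> r => x;
    apply: le_trans (fx x) _; rewrite ler_peMl.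
apply: ge_ereal_sup => _ [x /= x1 <-]; rewrite lee_fin.
exact: le_trans (fx x) x1.
Unshelve. all: by end_near. Qed.

Let lin_cont (T : topologicalType) (a : R) (u v w : T -> R) :
  continuous u -> continuous v -> continuous w ->
  continuous (fun t => u t - (a * v t + w t)).
Proof.
move=> cu cv cw t; apply: cvgB; first exact: cu.
by apply: cvgD; [apply: cvgM; [exact: cvg_cst|exact: cv]|exact: cw].
Qed.

Let norm_cont (T : topologicalType) (u : T -> R) :
  continuous u -> continuous (fun t => `|u t|).
Proof. by move=> cu t; apply: cvg_norm; exact: cu. Qed.

Lemma dual_ball_closed : closed (dual_ball E).
Proof.
have ev x : continuous (fun f : {ptws E -> R} => f x).
  exact: (@proj_continuous E (fun=> R) x).
have -> : dual_ball E =
    (\bigcap_(p in [set: R * E * E])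
       [set f : {ptws E -> R} |
         f (p.1.1 *: p.1.2 + p.2) - (p.1.1 * f p.1.2 + f p.2) = 0]) `&`
    (\bigcap_(x in [set: E]) [set f : {ptws E -> R} | `|f x| <= `|x|]).
  apply/seteqP; split=> f.
    move=> /dual_ballP[lf fx]; split=> [[[a x] y] _|x _] /=; last exact: fx.
    by rewrite (lf a x y) subrr.
  move=> [lf fx]; apply/dual_ballP; split=> [a x y|x]; last exact: fx.
  by apply/eqP; rewrite -subr_eq0; apply/eqP; exact: (lf (a, x, y)).
apply: closedI; apply: closed_bigI.
- move=> [[a x] y] _ /=.
  apply: (@preimage_closed _ _ (fun f : {ptws E -> R} =>
    f (a *: x + y) - (a * f x + f y)) [set 0]).
    by move=> f _; exact: (lin_cont (ev _) (ev x) (ev y)).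
  exact: closed_eq.
- move=> x _ /=.
  apply: (@preimage_closed _ _ (fun f : {ptws E -> R} => `|f x|)
    [set r | r <= `|x|]).
    by move=> f _; exact: (norm_cont (ev x)).
  exact: closed_le.
Qed.

(* Banach-Alaoglu *)
Lemma dual_ball_compact : compact (dual_ball E).
Proof.
apply: (@subclosed_compact {ptws E -> R} _
  [set f : {ptws E -> R} | forall x, `[- `|x|, `|x|]%classic (f x)]).
- exact: dual_ball_closed.
- apply: (@tychonoff E (fun=> R) (fun x => `[- `|x|, `|x|]%classic)) => x.
  exact: segment_compact.
- by move=> f /dual_ballP[_ fx] x; rewrite /= in_itv /= -ler_norml; exact: fx.
Qed.

Lemma compact_weakstar_ball : compact [set: dual_ball E].
Proof.
move=> F PF _.
have [f [Bf clf]] : dual_ball E `&` cluster (set_val @ F) !=set0.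
  apply: dual_ball_compact.
  have FT : F setT by exact: filterT.
  by apply: (@filterS _ F _ setT) => // g _; exact: set_valP.
exists (exist _ f (mem_set Bf)); split=> // A B FA.
move=> [_ [[W oW <-] /= Wf WB]].
have [|_ [[g Ag <-] Wg]] := clf (set_val @` A) W _ (open_nbhs_nbhs (conj oW Wf)).
  by apply: (@filterS _ F _ A) => // g Ag; exists g.
by exists g; split=> //; exact: WB.
Qed.

End dual_ball_compact.

Definition C_dual_ball (R : realType) (E : normedModType R)
    : normedFAlgType R :=
  contfun R (@compact_weakstar_ball R E).

(* Main.v *)
From HB Require Import structures.
Require Import Defs.
From mathcomp Require Import all_boot all_order all_algebra.
From mathcomp Require Import all_classical all_reals all_analysis.
From mathcomp Require Import ring lra.

(** The universal property applied to the evaluation map [eval], from [E] to the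
continuous functions on the dual ball, gives the embedding, its contractivity
and its uniqueness.  Everything else in this file serves injectivity.

Let [f] be in the kernel of [iota].  The first idea is that a normed f-algebra
has many real-valued characters.  In a normed f-algebra multiplication by [a] is
dominated by [`|a|] times the identity ([vabs_amul_le]), so it leaves every
principal order ideal invariant, together with the kernel of every real lattice
homomorphism [phi] on it.  If [phi u = 1], then [a |-> phi (amul a u)] is
therefore a contractive lattice-algebra homomorphism on the whole algebra
([character_linear], [character_join], [characterM], [character_le]); for the
free algebra it is the evaluation of [iota] at a point of the dual ball, because
the algebra is generated by the image of [eta] ([character_eval]).  Lattice
homomorphisms on the principal ideal of [u] separate its points, because the
norm makes the order Archimedean ([lattice_functional_separates]).  Hence
[amul f u = 0] for every [u >= 0]: the kernel of [iota] annihilates the algebra.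

Such annihilators are not excluded by f-algebra theory, since products may
vanish identically.  The second idea is to differentiate at the origin of the
dual ball.  Each [f] has a linear part [g], obtained by dropping all products
from an expression of [f] in the generators, and two properties hold
([linearizable_all]): [f - g] is dominated by a product of two positive
elements, and [iota f (t xs) = t * phi g + O(t^2)] whenever [xs] and the lattice
functional [phi] agree on the finitely many generators that occur in [f].  A
functional on finitely many vectors is the restriction of a bounded linear form
([bounded_form_interpolates], from Hahn-Banach), so suitable [xs] exist for every
[phi], and [iota f = 0] forces [g = 0].  Now [|f|] is annihilated by the algebra
and dominated by a product; an Archimedean f-algebra has no such element but [0]
([orthomorphism_kernel_disjoint]). *)

Set Implicit Arguments.
Unset Strict Implicit.
Unset Printing Implicit Defensive.

Import Order.TTheory GRing.Theory Num.Theory.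
Import numFieldNormedType.Exports.

Local Open Scope classical_set_scope.
Local Open Scope ring_scope.

Local Arguments vle_trans {R s y x z} _ _.
Local Arguments vleD2r {R s x y} z _.
Local Arguments vle_anti {R s x y} _ _.
Local Arguments vle_meet {R s x y z}.
Local Arguments vjoin_le {R s x y z}.
Local Arguments vscale_ge0 {R s a x} _ _.
Local Arguments amul_ge0 {R s x y} _ _.
Local Arguments famulP {R s a b c} _ _.
Local Arguments lattice_norm {R s x y} _.

Local Notation "x <=v y" := (vle x y) (at level 70, y at next level).

(** * Vector lattices *)

Section vector_lattice.
Variables (R : realType) (V : vectorLatticeType R).
Implicit Types (x y z t : V) (a b k l : R).

Lemma vsub_ge0 x y : 0 <=v y - x <-> x <=v y.
Proof.
split=> [/(vleD2r x)|/(vleD2r (- x))].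
  by rewrite add0r subrK.
by rewrite subrr.
Qed.

Lemma vleD x y z t : x <=v y -> z <=v t -> x + z <=v y + t.
Proof.
move=> xy zt; apply: (vle_trans (vleD2r z xy)).
by rewrite ![y + _]addrC; exact: vleD2r.
Qed.

Lemma vle_subl x y z : x - y <=v z <-> x <=v z + y.
Proof.
by split=> [/(vleD2r y)|/(vleD2r (- y))]; rewrite ?subrK ?addrK.
Qed.

Lemma vle_subr x y z : x <=v y - z <-> x + z <=v y.
Proof.
by split=> [/(vleD2r z)|/(vleD2r (- z))]; rewrite ?subrK ?addrK.
Qed.

Lemma vleN2 x y : x <=v y -> - y <=v - x.
Proof. by move=> xy; apply/vsub_ge0; rewrite opprK addrC; apply/vsub_ge0. Qed.

Lemma vaddr_ge0 x y : 0 <=v x -> 0 <=v y -> 0 <=v x + y.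
Proof. by move=> x0 y0; rewrite -(addr0 0); exact: vleD. Qed.

Lemma vle_addr x y : 0 <=v y -> x <=v x + y.
Proof. by move=> y0; rewrite -{1}(addr0 x); apply: vleD => //; exact: vle_refl. Qed.

Lemma vle_addl x y : 0 <=v y -> x <=v y + x.
Proof. by rewrite addrC; exact: vle_addr. Qed.

Lemma vscale_le a x y : 0 <= a -> x <=v y -> a *: x <=v a *: y.
Proof.
move=> a0 /vsub_ge0 xy; apply/vsub_ge0; rewrite -scalerBr.
exact: vscale_ge0.
Qed.

Lemma vscale_ler a b x : 0 <=v x -> a <= b -> a *: x <=v b *: x.
Proof.
move=> x0 ab; apply/vsub_ge0; rewrite -scalerBl; apply: vscale_ge0 => //.
by rewrite subr_ge0.
Qed.

Lemma vle_pdiv a x y : 0 < a -> x <=v a *: y -> a^-1 *: x <=v y.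
Proof.
move=> a0 xy; rewrite -[y](scalerK (lt0r_neq0 a0)).
by apply: vscale_le => //; rewrite invr_ge0 ltW.
Qed.

Lemma vmeet_lel x y : vmeet x y <=v x.
Proof. by have /vle_meet[] := vle_refl (vmeet x y). Qed.

Lemma vmeet_ler x y : vmeet x y <=v y.
Proof. by have /vle_meet[] := vle_refl (vmeet x y). Qed.

Lemma vle_joinl x y : x <=v vjoin x y.
Proof. by have /vjoin_le[] := vle_refl (vjoin x y). Qed.

Lemma vle_joinr x y : y <=v vjoin x y.
Proof. by have /vjoin_le[] := vle_refl (vjoin x y). Qed.

Lemma vjoinDr x y z : vjoin x y + z = vjoin (x + z) (y + z).
Proof.
apply: vle_anti; last first.
  by apply/vjoin_le; split; apply: vleD2r; [exact: vle_joinl|exact: vle_joinr].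
by apply/vle_subr/vjoin_le; split; apply/vle_subr;
  [exact: vle_joinl|exact: vle_joinr].
Qed.

Lemma vmeetDr x y z : vmeet x y + z = vmeet (x + z) (y + z).
Proof.
apply: vle_anti.
  by apply/vle_meet; split; apply: vleD2r; [exact: vmeet_lel|exact: vmeet_ler].
by apply/vle_subl/vle_meet; split; apply/vle_subl;
  [exact: vmeet_lel|exact: vmeet_ler].
Qed.

Lemma vmeetE x y : vmeet x y = x + y - vjoin x y.
Proof.
apply: vle_anti.
  apply/vle_subr; rewrite addrC; apply/vle_subr/vjoin_le; split; apply/vle_subr.
    by apply: vleD; [exact: vle_refl|exact: vmeet_ler].
  by rewrite (addrC x); apply: vleD; [exact: vle_refl|exact: vmeet_lel].
apply/vle_meet; split; apply/vle_subl; last rewrite addrC.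
  by apply: vleD; [exact: vle_refl|exact: vle_joinr].
by apply: vleD; [exact: vle_refl|exact: vle_joinl].
Qed.

Lemma vjoinC x y : vjoin x y = vjoin y x.
Proof.
by apply: vle_anti; apply/vjoin_le; split; do ?[exact: vle_joinl|exact: vle_joinr].
Qed.

Lemma vmeetC x y : vmeet x y = vmeet y x.
Proof. by rewrite !vmeetE vjoinC (addrC x). Qed.

Lemma vjoin_scale a x y : 0 <= a -> a *: vjoin x y = vjoin (a *: x) (a *: y).
Proof.
rewrite le_eqVlt => /predU1P[<-|a0].
  rewrite !scale0r; apply: vle_anti; first exact: vle_joinl.
  by apply/vjoin_le; split; exact: vle_refl.
have {}sc (b : R) z t : 0 < b -> vjoin (b *: z) (b *: t) <=v b *: vjoin z t.
  by move=> b0; apply/vjoin_le; split; apply: vscale_le (ltW b0) _;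
    [exact: vle_joinl|exact: vle_joinr].
apply: vle_anti; last exact: sc.
have := sc a^-1 (a *: x) (a *: y); rewrite invr_gt0 => /(_ a0).
rewrite !scalerA mulVf ?gt_eqF// !scale1r => /(vscale_le (ltW a0)).
by rewrite scalerA mulfV ?gt_eqF// scale1r.
Qed.

Lemma le_vabs x : x <=v vabs x. Proof. exact: vle_joinl. Qed.

Lemma leN_vabs x : - x <=v vabs x. Proof. exact: vle_joinr. Qed.

Lemma vabs_le x y : vabs x <=v y <-> x <=v y /\ - x <=v y.
Proof. exact: vjoin_le. Qed.

Lemma vabs_ge0 x : 0 <=v vabs x.
Proof.
have : 0 <=v 2 *: vabs x.
  rewrite scaler_nat mulr2n -(subrr x).
  by apply: vleD; [exact: le_vabs|exact: leN_vabs].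
have h0 : 0 <= 2^-1 :> R by rewrite invr_ge0.
by move=> /(vscale_ge0 h0); rewrite scalerA mulVf ?pnatr_eq0// scale1r.
Qed.

Lemma vabsN x : vabs (- x) = vabs x.
Proof. by rewrite /vabs opprK vjoinC. Qed.

Lemma vabs_id x : 0 <=v x -> vabs x = x.
Proof.
move=> x0; apply: vle_anti; last exact: le_vabs.
apply/vabs_le; split; first exact: vle_refl.
apply: (vle_trans _ x0); rewrite -oppr0; exact: vleN2.
Qed.

Lemma vabs_abs x : vabs (vabs x) = vabs x.
Proof. exact/vabs_id/vabs_ge0. Qed.

Lemma vabsD x y : vabs (x + y) <=v vabs x + vabs y.
Proof.
apply/vabs_le; split; first by apply: vleD; exact: le_vabs.
by rewrite opprD; apply: vleD; exact: leN_vabs.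
Qed.

Lemma vabsZ a x : vabs (a *: x) = `|a| *: vabs x.
Proof.
rewrite /vabs vjoin_scale ?normr_ge0// scalerN.
have [_|_] := ger0P a; first by [].
by rewrite !scaleNr opprK vjoinC.
Qed.

Lemma vabs_eq0 x : vabs x = 0 -> x = 0.
Proof.
move=> x0; apply: vle_anti; first by rewrite -x0; exact: le_vabs.
by rewrite -[x]opprK -oppr0; apply: vleN2; rewrite -x0; exact: leN_vabs.
Qed.

Lemma vabs_join x y z t :
  vabs (vjoin x y - vjoin z t) <=v vabs (x - z) + vabs (y - t).
Proof.
have H x' y' z' t' :
    vjoin x' y' - vjoin z' t' <=v vabs (x' - z') + vabs (y' - t').
  apply/vle_subl/vjoin_le; split.
    rewrite addrAC -[X in X <=v _](subrK z').
    apply: vle_trans (vle_addr _ (vabs_ge0 (y' - t'))).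
    by apply: vleD; [exact: le_vabs|exact: vle_joinl].
  rewrite -addrA -[X in X <=v _](subrK t').
  apply: vle_trans (vle_addl _ (vabs_ge0 (x' - z'))).
  by apply: vleD; [exact: le_vabs|exact: vle_joinr].
apply/vabs_le; split=> //; rewrite opprB.
by rewrite -(vabsN (x - z)) -(vabsN (y - t)) !opprB.
Qed.

Definition vpos x : V := vjoin x 0.

Lemma vpos_ge0 x : 0 <=v vpos x. Proof. exact: vle_joinr. Qed.

Lemma le_vpos x : x <=v vpos x. Proof. exact: vle_joinl. Qed.

Lemma vpos_le x y : 0 <=v y -> x <=v y -> vpos x <=v y.
Proof. by move=> y0 xy; apply/vjoin_le. Qed.

Lemma vpos_eq0 x : x <=v 0 -> vpos x = 0.
Proof.
by move=> x0; apply: vle_anti; [apply: vpos_le => //; exact: vle_refl|exact: vpos_ge0].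
Qed.

Lemma vpos_id x : 0 <=v x -> vpos x = x.
Proof.
move=> x0; apply: vle_anti; last exact: le_vpos.
by apply: vpos_le => //; exact: vle_refl.
Qed.

Lemma vposN x : vpos (- x) = vpos x - x.
Proof. by rewrite /vpos vjoinDr subrr add0r vjoinC. Qed.

Lemma vposB x : vpos x - vpos (- x) = x.
Proof. by rewrite vposN subKr. Qed.

Lemma vpos_disj x : vmeet (vpos x) (vpos (- x)) = 0.
Proof.
rewrite vmeetE; apply/eqP; rewrite subr_eq0; apply/eqP.
rewrite {1}/vpos vjoinDr add0r; congr (vjoin _ _).
by rewrite vposN addrCA subrr addr0.
Qed.

Lemma vabsE x : vabs x = vpos x + vpos (- x).
Proof.
rewrite vposN addrA -mulr2n -scaler_nat /vpos vjoin_scale// scaler0 vjoinDr.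
by rewrite scaler_nat mulr2n addrK add0r.
Qed.

Lemma vpos_le_abs x : vpos x <=v vabs x.
Proof. by apply: vpos_le; [exact: vabs_ge0|exact: le_vabs]. Qed.

(** Nearly all disjointness arguments below reduce to this form, in which no meet
has to be computed: an element that is dominated on both sides cannot exceed 0. *)
Lemma vdisj_le0 k l x y z : 0 <= k -> 0 <= l -> vmeet x y = 0 ->
  z <=v k *: x -> z <=v l *: y -> z <=v 0.
Proof.
move=> k0 l0 xy zx zy.
have x0 : 0 <=v x by rewrite -xy; exact: vmeet_lel.
have y0 : 0 <=v y by rewrite -xy; exact: vmeet_ler.
have K0 : 0 < k + l + 1 by rewrite ltr_wpDl// addr_ge0.
have [kK lK] : k <= k + l + 1 /\ l <= k + l + 1 by split; lra.
have : (k + l + 1)^-1 *: z <=v 0.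
  rewrite -xy; apply/vle_meet; split; apply: vle_pdiv => //.
    exact: vle_trans zx (vscale_ler x0 kK).
  exact: vle_trans zy (vscale_ler y0 lK).
by move=> /(vscale_le (ltW K0)); rewrite scalerKV ?gt_eqF// scaler0.
Qed.

Definition order_ideal u : set V := [set x | exists2 k, 0 <= k & vabs x <=v k *: u].

End vector_lattice.

(** * Functionals from total cones *)

(** Only nonempty chains need an upper bound: the families of interest consist of
sets that contain 0, and the empty union does not. *)
Lemma maximal_above (T : Type) (P : set (set T)) (A0 : set T) :
  P A0 ->
  (forall F : set (set T), F !=set0 -> F `<=` P -> total_on F subset ->
    P (\bigcup_(X in F) X)) ->
  exists A, [/\ A0 `<=` A, P A & forall B, A `<=` B -> P B -> B `<=` A].
Proof.
move=> P0 Pchain.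
(* Adding [A0] to every set makes the empty chain harmless. *)
have [|A [PA Amax]] := @Zorn_bigcup T [set X | P (A0 `|` X)].
  move=> F FP Ftot /=.
  have [->|/set0P[X0 FX0]] := eqVneq F set0; first by rewrite bigcup_set0 setU0.
  have -> : A0 `|` \bigcup_(X in F) X = \bigcup_(X in (setU A0) @` F) X.
    rewrite bigcup_image; apply/seteqP; split=> x.
      by move=> [A0x|[X FX Xx]]; [exists X0 => //; left|exists X => //; right].
    by move=> [X FX [A0x|Xx]]; [left|right; exists X].
  apply: Pchain; first by exists (A0 `|` X0); exists X0.
    by move=> _ [X FX <-]; exact: FP.
  move=> _ _ [X FX <-] [Y FY <-].
  by have [XY|YX] := Ftot _ _ FX FY; [left|right]; exact: setUS.
exists (A0 `|` A); split=> // B AB PB x Bx; apply: contrapT => Ax.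
apply: (Amax B); last by rewrite /= setUidr// => y A0y; apply: AB; left.
split; first by move=> y Ay; apply: AB; right.
by move=> BA; apply: Ax; right; exact: BA.
Qed.

Section cone.
Variables (R : realType) (V : lmodType R).
Implicit Types (M : set V) (u v w : V) (a b r e : R).

Definition convex_cone M :=
  forall a b v w, 0 <= a -> 0 <= b -> M v -> M w -> M (a *: v + b *: w).

Definition total_cone M := forall v, M v \/ M (- v).

Variables (M : set V) (u : V).
Hypotheses (coneM : convex_cone M) (totM : total_cone M) (nMu : ~ M (- u)).

Let coneD v w : M v -> M w -> M (v + w).
Proof. by move=> Mv Mw; rewrite -[v]scale1r -[w]scale1r; exact: coneM. Qed.

Let coneZ a v : 0 <= a -> M v -> M (a *: v).
Proof. by move=> a0 Mv; rewrite -[_ *: _]addr0 -(scale0r v); exact: coneM. Qed.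

Let Mu : M u. Proof. by have [|/nMu] := totM u. Qed.

Let cone_unit r : M (r *: u) -> 0 <= r.
Proof.
move=> Mr; rewrite leNgt; apply/negP => r0; apply: nMu.
have -> : - u = (- r)^-1 *: (r *: u).
  by rewrite scalerA invrN mulNr mulVf ?lt_eqF// scaleN1r.
by apply: coneZ => //; rewrite invr_ge0 oppr_ge0 ltW.
Qed.

Let near v r :=
  forall e, 0 < e -> M (v - (r - e) *: u) /\ M ((r + e) *: u - v).

Let near_le v w r s : near v r -> near w s -> M (w - v) -> r <= s.
Proof.
move=> vr ws Mwv; apply/ler_addgt0Pr => e e0.
have e20 : 0 < e / 2 by rewrite divr_gt0.
have [Mv _] := vr _ e20; have [_ Mw] := ws _ e20.
rewrite -subr_ge0; apply: cone_unit.
suff -> : (s + e - r) *: u =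
  (v - (r - e / 2) *: u) + (((s + e / 2) *: u - w) + (w - v)).
  exact: coneD Mv (coneD Mw Mwv).
rewrite subrKA [RHS]addrC subrKA -scalerBl.
by congr (_ *: u); lra.
Qed.

Let M0 : M 0. Proof. by rewrite -(scale0r u); exact: coneZ. Qed.

Let near_uniq v r s : near v r -> near v s -> r = s.
Proof.
have Mvv : M (v - v) by rewrite subrr.
move=> vr vs; apply/eqP; rewrite eq_le.
by rewrite (near_le vr vs Mvv) (near_le vs vr Mvv).
Qed.

Let nearD v w r s : near v r -> near w s -> near (v + w) (r + s).
Proof.
move=> vr ws e e0; have e20 : 0 < e / 2 by rewrite divr_gt0.
have [v1 v2] := vr _ e20; have [w1 w2] := ws _ e20.
split.
  have -> : r + s - e = (r - e / 2) + (s - e / 2) by lra.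
  by rewrite [_ *: u]scalerDl opprD addrACA; exact: coneD.
have -> : r + s + e = (r + e / 2) + (s + e / 2) by lra.
by rewrite [_ *: u]scalerDl opprD addrACA; exact: coneD.
Qed.

Let nearN v r : near v r -> near (- v) (- r).
Proof.
move=> vr e e0; have [v1 v2] := vr _ e0; split.
  have -> : - r - e = - (r + e) by lra.
  by rewrite scaleNr opprK [- v + _]addrC.
have -> : - r + e = - (r - e) by lra.
by rewrite scaleNr opprK [- _ + v]addrC.
Qed.

Let nearZ a v r : near v r -> near (a *: v) (a * r).
Proof.
wlog a0 : a / 0 <= a.
  move=> H vr; have [a0|a0] := leP 0 a; first exact: H.
  rewrite -[a]opprK mulNr scaleNr; apply: nearN; apply: H => //.
  by rewrite oppr_ge0 ltW.
move=> vr e e0; move: a0; rewrite le_eqVlt => /predU1P[<-|a0].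
  rewrite mul0r scale0r !sub0r add0r subr0 scaleNr opprK.
  by split; apply: coneZ => //; exact: ltW.
have [v1 v2] := vr _ (divr_gt0 e0 a0).
have -> : a * r - e = a * (r - e / a) by rewrite mulrBr mulrCA mulfV ?mulr1 ?gt_eqF.
have -> : a * r + e = a * (r + e / a) by rewrite mulrDr mulrCA mulfV ?mulr1 ?gt_eqF.
by rewrite -!scalerA -!scalerBr; split; apply: coneZ => //; exact: ltW.
Qed.

(** The elements for which [u] is an order unit, for the preorder defined by the
cone [M]. *)
Definition cone_bounded v := exists k, M (k *: u - v) /\ M (k *: u + v).

Let near_exists v : cone_bounded v -> exists r, near v r.
Proof.
move=> [k [kv1 kv2]]; pose S := [set r | M (v - r *: u)].
have supS : has_sup S.
  split; first by exists (- k); rewrite /S /= scaleNr opprK addrC.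
  exists k => r Sr; rewrite -subr_ge0; apply: cone_unit.
  by rewrite scalerBl -(subrKA v); exact: coneD.
exists (sup S) => e e0; split.
  have [r Sr rS] := sup_adherent e0 supS.
  have -> : v - (sup S - e) *: u = (v - r *: u) + (r - (sup S - e)) *: u.
    by rewrite [(r - _) *: u]scalerBl subrKA.
  by apply: coneD => //; apply: coneZ => //; rewrite subr_ge0 ltW.
have [|] := totM (v - (sup S + e) *: u); last by rewrite opprB.
move=> /(ub_le_sup (proj2 supS)); rewrite gerDl => /(lt_le_trans e0).
by rewrite ltxx.
Qed.

(** For a total cone and [v] bounded by [u], the set of [r] with [v - r *: u] in
[M] is a half-line up to its endpoint, and the endpoint depends linearly on [v]:
it is the only [r] such that [v] lies between [(r - e) *: u] and [(r + e) *: u]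
for every [e > 0].  The order of a totally ordered quotient is thus collapsed onto
the real line, infinitesimals going to [0].  This yields both lattice
homomorphisms and Hahn-Banach functionals. *)
Lemma total_cone_functional : exists f : V -> R,
  [/\ forall a v w, cone_bounded v -> cone_bounded w ->
        f (a *: v + w) = a * f v + f w,
      forall v, cone_bounded v -> M v -> 0 <= f v & f u = 1].
Proof.
exists (fun v => xget 0 [set r | near v r]).
have H v : cone_bounded v -> near v (xget 0 [set r | near v r]).
  by move=> /near_exists[r vr]; case: xgetP => [|/(_ r)].
have U v r : near v r -> xget 0 [set r | near v r] = r.
  by move=> vr; apply: (near_uniq _ vr); case: xgetP => [//|/(_ r)].
split=> [a v w /H vr /H ws|v /H vr Mv|].
- by apply: U; apply: nearD => //; exact: nearZ.
- have n0 : near 0 0.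
    move=> e e0; rewrite !sub0r add0r subr0 scaleNr opprK.
    by split; apply: coneZ => //; exact: ltW.
  by apply: (near_le n0 vr); rewrite subr0.
- apply: U => e e0; rewrite -{1 4}[u]scale1r -!scalerBl.
  by split; apply: coneZ => //; lra.
Qed.

End cone.

(** A maximal cone [M] that avoids [- u] is total: if neither [v] nor [- v] is in
[M], then [- u] belongs to both [M + R_+ v] and [M - R_+ v], and a convex
combination cancelling [v] puts [- u] in [M]. *)
Lemma total_cone_exists (R : realType) (V : lmodType R) (C : set V) (u : V) :
  C 0 -> convex_cone C -> ~ C (- u) ->
  exists M, [/\ C `<=` M, convex_cone M, total_cone M & ~ M (- u)].
Proof.
move=> C0 coneC nCu.
have [//||M [CM [coneM nMu] Mmax]] :=
  @maximal_above V [set M | convex_cone M /\ ~ M (- u)] C.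
  move=> F F0 FP Ftot; split; last by move=> [X /FP[_]].
  move=> a b v w a0 b0 [X FX Xv] [Y FY Yw].
  have [XY|YX] := Ftot _ _ FX FY.
    by exists Y => //; have [H _] := FP _ FY; apply: H => //; exact: XY.
  by exists X => //; have [H _] := FP _ FX; apply: H => //; exact: YX.
exists M; split=> // v.
have M0 := CM _ C0.
have generated w : M w \/ exists m a, [/\ M m, 0 <= a & - u = m + a *: w].
  pose N := [set x | exists m a, [/\ M m, 0 <= a & x = m + a *: w]].
  have [Nu|nNu] := pselect (N (- u)); first by right.
  left; apply: (Mmax N); last by exists 0, 1; split; rewrite ?add0r ?scale1r.
    by move=> x Mx; exists x, 0; split; rewrite ?scale0r ?addr0.
  split=> // a b _ _ a0 b0 [m [c [Mm c0 ->]]] [m' [c' [Mm' c'0 ->]]].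
  exists (a *: m + b *: m'), (a * c + b * c'); split; first exact: coneM.
    by rewrite addr_ge0// mulr_ge0.
  by rewrite !scalerDr addrACA !scalerA scalerDl.
have [|[m [a [Mm a0 um]]]] := generated v; first by left.
have [|[m' [b [Mm' b0 um']]]] := generated (- v); first by right.
exfalso; apply: nMu.
have [ab|ab] := eqVneq (a + b) 0.
  have a00 : a = 0 by lra.
  by rewrite um a00 scale0r addr0.
have ab0 : 0 < a + b by rewrite lt_neqAle eq_sym ab addr_ge0.
have -> : - u = (b / (a + b)) *: m + (a / (a + b)) *: m'.
  apply: (scalerI ab); rewrite scalerDr !scalerA ![(a + b) * _]mulrC.
  rewrite !divfK// addrC scalerDl {1}um um' !scalerDr !scalerA scalerN.
  rewrite addrACA (mulrC b a) -[RHS]addr0; congr (_ + _).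
  by rewrite subrr.
by apply: coneM => //; rewrite divr_ge0// ltW.
Qed.

(** * Lattice functionals on principal ideals *)

Section lattice_functionals.
Variables (R : realType) (V : vectorLatticeType R).
Implicit Types (I : set V) (u v w x y z : V) (k : R) (phi : V -> R).

(** One condition packs solidity and stability under sums and multiples. *)
Definition lattice_ideal I :=
  I 0 /\ forall k x y z, 0 <= k -> I x -> I y ->
    vabs z <=v k *: (vabs x + vabs y) -> I z.

Lemma lattice_idealS I x z : lattice_ideal I -> I x -> vabs z <=v vabs x -> I z.
Proof.
move=> [I0 II] Ix zx; apply: (II 1 x 0 z ler01 Ix I0).
by rewrite scale1r (vabs_id (vle_refl 0)) addr0.
Qed.

Lemma lattice_idealD I x y : lattice_ideal I -> I x -> I y -> I (x + y).
Proof.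
by move=> [_ II] Ix Iy; apply: (II 1 x y _ ler01) => //; rewrite scale1r; exact: vabsD.
Qed.

Lemma lattice_idealZ I k x : lattice_ideal I -> 0 <= k -> I x -> I (k *: x).
Proof.
move=> [I0 II] k0 Ix; apply: (II k x 0 _ k0) => //.
rewrite (vabs_id (vle_refl 0)) addr0 vabsZ ger0_norm//; exact: vle_refl.
Qed.

Lemma lattice_ideal_abs I x : lattice_ideal I -> I x -> I (vabs x).
Proof.
by move=> LI Ix; apply: (lattice_idealS LI Ix); rewrite vabs_abs; exact: vle_refl.
Qed.

Lemma lattice_ideal_order u : 0 <=v u -> lattice_ideal (order_ideal u).
Proof.
move=> u0; split.
  by exists 0 => //; rewrite scale0r (vabs_id (vle_refl 0)); exact: vle_refl.
move=> k x y z k0 [a a0 xa] [b b0 yb] zxy.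
exists (k * (a + b)); first by rewrite mulr_ge0// addr_ge0.
apply: (vle_trans zxy); rewrite -scalerA scalerDl; apply: vscale_le => //.
exact: vleD.
Qed.

(** An ideal that is maximal among those avoiding [u] is prime: if it contains
neither [v^+] nor [v^-], then [u] is dominated, modulo the ideal, by multiples of
both; these are disjoint, so [u] is in the ideal. *)
Lemma prime_ideal_exists I0 u : 0 <=v u -> lattice_ideal I0 -> ~ I0 u ->
  exists I, [/\ I0 `<=` I, lattice_ideal I, ~ I u &
    forall v, I (vpos v) \/ I (vpos (- v))].
Proof.
move=> u0 LI0 nI0u.
have [//||I [I0I [LI nIu] Imax]] :=
  @maximal_above V [set I | lattice_ideal I /\ ~ I u] I0.
  move=> F [X0 FX0] FP Ftot; split; last by move=> [X /FP[_]].
  split; first by exists X0 => //; have [[]] := FP _ FX0.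
  move=> k x y z k0 [X FX Xx] [Y FY Yy] zxy.
  have [XY|YX] := Ftot _ _ FX FY.
    by exists Y => //; have [[_ H] _] := FP _ FY; apply: (H k x y) => //; exact: XY.
  by exists X => //; have [[_ H] _] := FP _ FX; apply: (H k x y) => //; exact: YX.
exists I; split=> // v; apply: contrapT => nI.
(* [N] is the ideal generated by [I] and [w]. *)
have generated w : ~ I w ->
    exists m k, [/\ I m, 0 <= k & u <=v vabs m + k *: vabs w].
  move=> nIw; pose N := [set z | exists m k,
    [/\ I m, 0 <= k & vabs z <=v vabs m + k *: vabs w]].
  have IN : I `<=` N.
    by move=> z Iz; exists z, 0; split; rewrite ?scale0r ?addr0//; exact: vle_refl.
  have [Nu|nNu] := pselect (N u).
    by have [m [k [Im k0]]] := Nu; rewrite (vabs_id u0) => H; exists m, k.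
  have LN : lattice_ideal N.
    split; first exact/IN/LI.1.
    move=> k x y z k0 [m [a [Im a0 xm]]] [m' [b [Im' b0 ym']]] zxy.
    exists (k *: (vabs m + vabs m')), (k * (a + b)); split.
    - by apply: lattice_idealZ => //; apply: lattice_idealD => //;
        exact: lattice_ideal_abs.
    - by rewrite mulr_ge0// addr_ge0.
    - apply: (vle_trans zxy); rewrite [vabs (k *: _)]vabs_id; last first.
        by apply: vscale_ge0 => //; apply: vaddr_ge0; exact: vabs_ge0.
      rewrite -scalerA -scalerDr; apply: vscale_le => //.
      by rewrite scalerDl addrACA; exact: vleD.
  exfalso; apply: nIw; apply: (Imax N) => //; exists 0, 1; split => //.
    exact: LI.1.
  by rewrite (vabs_id (vle_refl 0)) add0r scale1r; exact: vle_refl.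
have nIv : ~ I (vpos v) by move=> Iv; apply: nI; left.
have nIv' : ~ I (vpos (- v)) by move=> Iv; apply: nI; right.
have [m [k [Im k0 um]]] := generated _ nIv.
have [m' [k' [Im' k'0 um']]] := generated _ nIv'.
rewrite !(vabs_id (vpos_ge0 _)) in um um'.
apply: nIu; apply: (@lattice_idealS _ (vabs m + vabs m')) => //.
  by apply: lattice_idealD => //; exact: lattice_ideal_abs.
rewrite (vabs_id u0) (vabs_id (vaddr_ge0 (vabs_ge0 _) (vabs_ge0 _))).
apply/vsub_ge0; rewrite -opprB -oppr0; apply: vleN2.
apply: (vdisj_le0 k0 k'0 (vpos_disj v)); apply/vle_subl.
  apply: (vle_trans um); rewrite addrC; apply: vleD; first exact: vle_refl.
  by apply: vle_addr; exact: vabs_ge0.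
apply: (vle_trans um'); rewrite addrC; apply: vleD; first exact: vle_refl.
by apply: vle_addl; exact: vabs_ge0.
Qed.

(** A real lattice homomorphism on the principal ideal [order_ideal u]; the values
of [phi] elsewhere are arbitrary. *)
Definition lattice_functional u phi :=
  (forall a x y, order_ideal u x -> order_ideal u y ->
    phi (a *: x + y) = a * phi x + phi y) /\
  (forall x y, order_ideal u x -> order_ideal u y ->
    phi (vjoin x y) = Num.max (phi x) (phi y)).

(** The elements whose negative part is in a prime ideal form a total cone. *)
Lemma prime_ideal_functional I u : 0 <=v u -> lattice_ideal I -> ~ I u ->
  (forall v, I (vpos v) \/ I (vpos (- v))) ->
  exists phi, [/\ lattice_functional u phi, phi u = 1 &
    forall v, order_ideal u v -> I (vpos (- v)) -> 0 <= phi v].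
Proof.
move=> u0 LI nIu primeI; pose M := [set v | I (vpos (- v))].
have coneM : convex_cone M.
  move=> a b x y a0 b0 Mx My.
  apply: (@lattice_idealS I (a *: vpos (- x) + b *: vpos (- y)) _ LI).
    by apply: (lattice_idealD LI); exact: (lattice_idealZ LI).
  have H0 : 0 <=v a *: vpos (- x) + b *: vpos (- y).
    by apply: vaddr_ge0; apply: vscale_ge0 => //; exact: vpos_ge0.
  rewrite (vabs_id H0) (vabs_id (vpos_ge0 _)); apply: vpos_le => //.
  by rewrite opprD -!scalerN; apply: vleD; apply: vscale_le => //; exact: le_vpos.
have totM : total_cone M.
  by move=> v; have [Iv|Iv] := primeI v; [right; rewrite /M /= opprK|left].
have nMu : ~ M (- u).
  rewrite /M /= opprK => Iu; apply: nIu; apply: (lattice_idealS LI Iu).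
  by rewrite (vabs_id u0) (vabs_id (vpos_ge0 _)); exact: le_vpos.
have Mpos v : 0 <=v v -> M v.
  move=> v0; rewrite /M /= vpos_eq0; first exact: LI.1.
  by rewrite -oppr0; exact: vleN2.
have bnd v : order_ideal u v -> cone_bounded M u v.
  move=> [k k0 vk]; exists k; split; apply: Mpos.
    by apply/vsub_ge0; exact: vle_trans (le_vabs v) vk.
  by rewrite -[v]opprK; apply/vsub_ge0; exact: vle_trans (leN_vabs v) vk.
have [phi [philin phi0 phiu]] := total_cone_functional coneM totM nMu.
have LU := lattice_ideal_order u0.
exists phi; split=> [|//|v /bnd]; last exact: phi0.
split=> [a x y /bnd xu /bnd yu|]; first exact: philin.
have phiD x y : order_ideal u x -> order_ideal u y -> phi (x + y) = phi x + phi y.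
  by move=> /bnd xu /bnd yu; rewrite -[x in LHS]scale1r philin// mul1r.
have phi00 : phi 0 = 0.
  by apply: (addIr (phi 0)); rewrite -phiD ?addr0 ?add0r//; exact: LU.1.
have phiN x : order_ideal u x -> phi (- x) = - phi x.
  move=> xu; rewrite -scaleN1r -[_ *: _]addr0 philin ?mulN1r ?phi00 ?addr0//.
    exact: bnd.
  exact/bnd/LU.1.
have idealN x : order_ideal u x -> order_ideal u (- x).
  by move=> xu; apply: (lattice_idealS LU xu); rewrite vabsN; exact: vle_refl.
have H x y : order_ideal u x -> order_ideal u y -> M (x - y) ->
    phi (vjoin x y) = phi x /\ phi y <= phi x.
  move=> xu yu Mxy.
  have xyu : order_ideal u (x - y) by apply: lattice_idealD => //; exact: idealN.
  split; last first.
    by rewrite -subr_ge0 -phiN// -phiD//; [apply: phi0 => //; exact: bnd|exact: idealN].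
  set p := vpos (y - x).
  have pu : order_ideal u p.
    apply: (lattice_idealS LU xyu); rewrite (vabs_id (vpos_ge0 _)) -vabsN opprB.
    exact: vpos_le_abs.
  have -> : vjoin x y = x + p by rewrite addrC /p /vpos vjoinDr subrK add0r vjoinC.
  rewrite phiD//; suff -> : phi p = 0 by rewrite addr0.
  apply/eqP; rewrite eq_le; apply/andP; split; last first.
    by apply: phi0; [exact: bnd|exact/Mpos/vpos_ge0].
  rewrite -oppr_ge0 -phiN//; apply: phi0; first exact/bnd/idealN.
  by move: Mxy; rewrite /M /= !opprK opprB (vpos_id (vpos_ge0 _)).
move=> x y xu yu; have [|] := totM (x - y).
  by move=> /(H _ _ xu yu)[-> yx]; rewrite max_l.
by rewrite opprB vjoinC => /(H _ _ yu xu)[-> xy]; rewrite max_r.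
Qed.

Lemma lattice_functionalZl u phi k : 0 <= k ->
  lattice_functional u phi -> lattice_functional u (fun f => k * phi f).
Proof.
move=> k0 [H1 H2]; split=> [a x y xu yu|x y xu yu]; first by rewrite H1//; ring.
by rewrite H2// maxr_pMr.
Qed.

End lattice_functionals.

Section lattice_functional_theory.
Variables (R : realType) (V : vectorLatticeType R) (u : V) (phi : V -> R).
Hypotheses (u0 : 0 <=v u) (Hphi : lattice_functional u phi).
Implicit Types (v w x y z : V) (k a M : R).
Local Notation Iu := (order_ideal u).
Let LU := lattice_ideal_order u0.

Lemma order_ideal0 : Iu 0. Proof. exact: LU.1. Qed.

Lemma order_idealZD a x y : Iu x -> Iu y -> Iu (a *: x + y).
Proof.
move=> xu yu; apply: lattice_idealD => //.
have [_ H] := LU; apply: (H `|a| x 0) => //; first exact: order_ideal0.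
by rewrite (vabs_id (vle_refl 0)) addr0 vabsZ; exact: vle_refl.
Qed.

Lemma order_ideal_join x y : Iu x -> Iu y -> Iu (vjoin x y).
Proof.
move=> xu yu; have [_ H] := LU; apply: (H 1 x y) => //.
rewrite scale1r.
have := vabs_join x y 0 0; rewrite !subr0.
have -> : vjoin 0 0 = 0 :> V.
  by apply: vle_anti; [apply/vjoin_le; split; exact: vle_refl|exact: vle_joinl].
by rewrite subr0.
Qed.

Lemma order_ideal_unit : Iu u.
Proof. by exists 1 => //; rewrite scale1r (vabs_id u0); exact: vle_refl. Qed.

Lemma lattice_functional0 : phi 0 = 0.
Proof.
have [H _] := Hphi; have := H 1 0 0 order_ideal0 order_ideal0.
rewrite scaler0 addr0 mul1r => /(congr1 (fun r => r - phi 0)).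
by rewrite subrr addrK => <-.
Qed.

Lemma lattice_functionalZ a x : Iu x -> phi (a *: x) = a * phi x.
Proof.
move=> xu; have [H _] := Hphi; rewrite -[_ *: _]addr0 H//.
  by rewrite lattice_functional0 addr0.
exact: order_ideal0.
Qed.

Lemma lattice_functional_abs x : Iu x -> phi (vabs x) = `|phi x|.
Proof.
move=> xu; have xu' : Iu (- x).
  by apply: (lattice_idealS LU xu); rewrite vabsN; exact: vle_refl.
have [_ H] := Hphi; rewrite /vabs H// -maxrN; congr Num.max.
by rewrite -scaleN1r lattice_functionalZ// mulN1r.
Qed.

Lemma lattice_functional_ge0 x : Iu x -> 0 <=v x -> 0 <= phi x.
Proof. by move=> xu x0; rewrite -(vabs_id x0) lattice_functional_abs. Qed.

Lemma lattice_functional_le x y : Iu x -> Iu y -> x <=v y -> phi x <= phi y.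
Proof.
move=> xu yu /vsub_ge0 xy; rewrite -subr_ge0.
have yxu : Iu (y - x) by rewrite addrC -scaleN1r; exact: order_idealZD.
have := lattice_functional_ge0 yxu xy.
by rewrite addrC -scaleN1r (Hphi.1)// mulN1r addrC.
Qed.

(** An operator dominated by a multiple of the identity maps the kernel of [phi]
to itself, and [v - phi v *: u] is in that kernel: [phi] is an eigenvector of the
adjoint. *)
Lemma functional_eigen (T : V -> V) M : phi u = 1 ->
  (forall k x y, T (k *: x + y) = k *: T x + T y) ->
  (forall x, vabs (T x) <=v M *: vabs x) -> 0 <= M ->
  forall v, order_ideal u v -> phi (T v) = phi (T u) * phi v.
Proof.
move=> phiu Tlin TM M0 v vu.
have uu := order_ideal_unit.
have TI w : order_ideal u w -> order_ideal u (T w).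
  move=> wu; apply: (lattice_idealS LU
    (lattice_idealZ LU M0 (lattice_ideal_abs LU wu))).
  rewrite [X in _ <=v X]vabs_id; first exact: TM.
  by apply: vscale_ge0 => //; exact: vabs_ge0.
pose w := - phi v *: u + v.
have wu : order_ideal u w by exact: order_idealZD.
have phiw : phi w = 0 by rewrite /w (Hphi.1)// phiu mulr1 addNr.
have : phi (T w) = 0.
  apply/eqP; rewrite -normr_le0 -lattice_functional_abs; last exact: TI.
  rewrite -(mulr0 M) -(normr0 R) -phiw -(lattice_functional_abs wu).
  rewrite -lattice_functionalZ; last exact: lattice_ideal_abs.
  apply: (lattice_functional_le _ _ (TM w)).
    by apply: (lattice_ideal_abs LU); exact: TI.
  by apply: (lattice_idealZ LU) => //; exact: lattice_ideal_abs.
rewrite Tlin (Hphi.1); [|exact: TI|exact: TI].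
by move=> /eqP; rewrite mulNr addrC subr_eq0 mulrC => /eqP.
Qed.

End lattice_functional_theory.

(** * Orthomorphisms *)

Section orthomorphism.
Variables (R : realType) (V : vectorLatticeType R).
Implicit Types (v w x y z : V) (k l : R).

Definition positive_orthomorphism (pi : V -> V) :=
  [/\ forall k x y, pi (k *: x + y) = k *: pi x + pi y,
      forall x, 0 <=v x -> 0 <=v pi x &
      forall x y, vmeet x y = 0 -> vmeet (pi x) y = 0].

Variable pi : V -> V.
Hypothesis Hpi : positive_orthomorphism pi.

Let piD x y : pi (x + y) = pi x + pi y.
Proof. by have [H _ _] := Hpi; rewrite -[x in LHS]scale1r H scale1r. Qed.

Let pi0 : pi 0 = 0.
Proof. by apply: (addIr (pi 0)); rewrite -piD !add0r. Qed.

Let piN x : pi (- x) = - pi x.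
Proof. by apply: (addIr (pi x)); rewrite -piD !addNr pi0. Qed.

Let piZ k x : pi (k *: x) = k *: pi x.
Proof. by have [H _ _] := Hpi; rewrite -[_ *: x]addr0 H pi0 addr0. Qed.

Let pi_ge0 x : 0 <=v x -> 0 <=v pi x.
Proof. by have [_ H _] := Hpi; exact: H. Qed.

(** Subtracting [vmeet x y] makes [x] and [y] disjoint, and two applications of the
band-preservation axiom keep their images disjoint. *)
Lemma orthomorphism_meet x y : pi (vmeet x y) = vmeet (pi x) (pi y).
Proof.
have [_ _ pid] := Hpi.
have : vmeet (x - vmeet x y) (y - vmeet x y) = 0 by rewrite -vmeetDr subrr.
move=> /pid; rewrite vmeetC => /pid; rewrite vmeetC !piD piN -vmeetDr.
by move=> /eqP; rewrite subr_eq0 => /eqP.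
Qed.

Lemma orthomorphism_join x y : pi (vjoin x y) = vjoin (pi x) (pi y).
Proof.
apply/eqP; rewrite -subr_eq0.
have E (z t : V) : vjoin z t = z + t - vmeet z t by rewrite vmeetE subKr.
by rewrite [vjoin x y]E [X in _ - X]E !piD piN orthomorphism_meet subrr.
Qed.

Lemma orthomorphism_abs x : pi (vabs x) = vabs (pi x).
Proof. by rewrite /vabs orthomorphism_join piN. Qed.

Lemma orthomorphism_le x y : x <=v y -> pi x <=v pi y.
Proof. by move=> /vsub_ge0 xy; apply/vsub_ge0; rewrite -piN -piD; exact: pi_ge0. Qed.

Let iter_le n x y : x <=v y -> iter n pi x <=v iter n pi y.
Proof. by move=> xy; elim: n => //= n IH; exact: orthomorphism_le. Qed.

Let iterB n x y : iter n pi (x - y) = iter n pi x - iter n pi y.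
Proof. by elim: n => //= n ->; rewrite piD piN. Qed.

Let iterZ n k x : iter n pi (k *: x) = k *: iter n pi x.
Proof. by elim: n => //= n ->; rewrite piZ. Qed.

(** The pointwise inequality [l^n (s - l)^+ <= s^(n+1)], for a multiplier [s >= 0].
At each step the positive part of the difference of the two sides lives on the
band where [pi v > l *: v], and is at the same time dominated by the image of
[(pi v - l *: v)^-], which is disjoint from that band. *)
Lemma orthomorphism_power_le l v n : 0 <= l -> 0 <=v v ->
  l ^+ n *: vpos (pi v - l *: v) <=v iter n.+1 pi v.
Proof.
move=> l0 v0; set w := pi v - l *: v; have [_ _ pid] := Hpi.
elim: n => [|n IH].
  rewrite scale1r /=; apply: vpos_le; first exact: pi_ge0.
  by apply/vle_subl; apply: vle_addr; exact: vscale_ge0.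
have ipos m x : 0 <=v x -> 0 <=v iter m pi x.
  by move=> x0; elim: m => //= m; exact: pi_ge0.
(* Band preservation carries [w^- _|_ w^+] to the iterates. *)
have disj : vmeet (iter n.+1 pi (vpos (- w))) (vpos w) = 0.
  by elim: n.+1 => [|m H]; [rewrite vmeetC vpos_disj|rewrite iterS pid].
rewrite -[X in _ <=v X]add0r; apply/vle_subl; apply: (vle_trans (le_vpos _)).
apply: (vdisj_le0 (k := 1) (l := l ^+ n.+1) _ _ disj) => //; first exact: exprn_ge0.
  rewrite scale1r; apply: vpos_le; first exact/ipos/vpos_ge0.
  apply: (@vle_trans _ _ (l *: iter n.+1 pi v - iter n.+2 pi v)).
    by apply: vleD2r; rewrite exprS -scalerA; exact: vscale_le.
  rewrite -iterZ [iter n.+2 _ _]iterSr -iterB; apply: iter_le.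
  by rewrite -opprB; exact: le_vpos.
apply: vpos_le; first by apply: vscale_ge0; [exact: exprn_ge0|exact: vpos_ge0].
by apply/vle_subl; apply: vle_addr; exact: ipos.
Qed.

End orthomorphism.

(** * Normed lattice algebras *)

Section normed_lattice.
Variables (R : realType) (A : normedFAlgType R).
Implicit Types (u v w x y z : A) (k M l : R) (pi : A -> A).

Lemma norm_vabs x : `|vabs x| = `|x| :> R.
Proof.
by apply/eqP; rewrite eq_le !lattice_norm// vabs_abs; exact: vle_refl.
Qed.

Lemma norm_le_pos x y : 0 <=v x -> x <=v y -> `|x| <= `|y| :> R.
Proof.
move=> x0 xy; apply: lattice_norm; rewrite (vabs_id x0).
by rewrite vabs_id//; exact: vle_trans x0 xy.
Qed.

Lemma normed_archimedean u x : (forall e, 0 < e -> x <=v e *: u) -> x <=v 0.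
Proof.
move=> H; apply: (vle_trans (le_vpos x)).
suff -> : vpos x = 0 by exact: vle_refl.
apply/normr0_eq0/eqP; rewrite eq_le normr_ge0 andbT; apply/ler_addgt0Pr => e e0.
have u0 : 0 < `|u| + 1 by rewrite ltr_wpDl.
have d0 : 0 < e / (`|u| + 1) by rewrite divr_gt0.
rewrite add0r; apply: (@le_trans _ _ (e / (`|u| + 1) * `|u|)); last first.
  by rewrite mulrAC ler_pdivrMr// ler_pM2l// lerDl.
rewrite -[X in X * _](gtr0_norm d0) -normrZ.
apply: lattice_norm.
rewrite (vabs_id (vpos_ge0 _)); apply: vpos_le; first exact: vabs_ge0.
exact: vle_trans (H _ d0) (le_vabs _).
Qed.

(** Take [e > 0] with [w := |y| - e u] not negative.  As [w^+] is not zero and is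
disjoint from [w^-], the ideal of [w^-] does not contain [u]; a prime ideal above
it gives a functional with [phi w >= 0], that is [phi |y| >= e]. *)
Lemma lattice_functional_separates u y : 0 <=v u -> order_ideal u y -> y <> 0 ->
  exists phi, [/\ lattice_functional u phi, phi u = 1 & phi y <> 0].
Proof.
move=> u0 yu y0.
have [e [e0 nye]] : exists e, 0 < e /\ ~ vabs y <=v e *: u.
  apply: contrapT => H; apply: y0; apply/vabs_eq0/vle_anti; last exact: vabs_ge0.
  apply: (@normed_archimedean u) => e e0; apply: contrapT => ye.
  by apply: H; exists e.
pose w := vabs y - e *: u.
have LU := lattice_ideal_order u0.
have nu : ~ order_ideal (vpos (- w)) u.
  move=> [k k0]; rewrite (vabs_id u0) => uk; apply: nye.
  rewrite -[X in _ <=v X]add0r; apply/vle_subl; apply: (vle_trans (le_vpos w)).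
  have [c c0 yc] := yu.
  apply: (@vdisj_le0 _ _ 1 (c * k) _ _ _ ler01 (mulr_ge0 c0 k0) (vpos_disj w)).
    by rewrite scale1r; exact: vle_refl.
  rewrite -scalerA; apply: (@vle_trans _ _ (c *: u)); last exact: vscale_le.
  apply: vpos_le; first exact: vscale_ge0.
  apply: vle_trans yc; apply/vle_subl; apply: vle_addr; apply: vscale_ge0 => //.
  exact: ltW.
have [I [I0I LI nIu Iprime]] :=
  prime_ideal_exists u0 (lattice_ideal_order (vpos_ge0 (- w))) nu.
have [phi [Hphi phiu phi0]] := prime_ideal_functional u0 LI nIu Iprime.
exists phi; split=> //.
have yu' : order_ideal u (vabs y) by exact: lattice_ideal_abs.
have uu := order_ideal_unit u0.
have wu : order_ideal u w by rewrite /w addrC -scaleNr; exact: order_idealZD.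
have : 0 <= phi w.
  by apply: phi0 => //; apply: I0I; apply: order_ideal_unit; exact: vpos_ge0.
rewrite /w addrC -scaleNr (Hphi.1)// phiu mulr1 (lattice_functional_abs u0 Hphi)//.
by move=> H y00; move: H; rewrite y00 normr0 addr0 oppr_ge0 leNgt e0.
Qed.

(** A positive orthomorphism of norm at most [M] is dominated by [M] times the
identity.  For [l > M] the positive part [x] of [pi v - l *: v] satisfies
[l^n `|x| <= `|pi^(n+1) v| <= M^(n+1) `|v|] for all [n], so it vanishes; then let
[l] tend to [M].  Going through powers of [pi] avoids completeness and the theory
of commuting orthomorphisms. *)
Lemma orthomorphism_bound pi M v : positive_orthomorphism pi -> 0 <= M ->
  (forall x, `|pi x| <= M * `|x|) -> 0 <=v v -> pi v <=v M *: v.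
Proof.
move=> Hpi M0 piM v0; rewrite -[X in _ <=v X]add0r; apply/vle_subl.
apply: (@normed_archimedean v) => e e0; apply/vle_subl; rewrite -scalerDl.
pose l := e + M; have lM : M < l by rewrite ltrDr.
have l0 : 0 < l by exact: le_lt_trans lM.
rewrite -[X in _ <=v X]add0r; apply/vle_subl; apply: (vle_trans (le_vpos _)).
rewrite -/l; set x := vpos _.
suff -> : x = 0 by exact: vle_refl.
apply/normr0_eq0/eqP; rewrite eq_le normr_ge0 andbT.
have iterM n : `|iter n pi v| <= M ^+ n * `|v|.
  elim: n => [|n IH] /=; first by rewrite mul1r.
  by apply: (le_trans (piM _)); rewrite exprS -mulrA ler_wpM2l.
have xn n : `|x| <= (M / l) ^+ n * (M * `|v|).
  have := norm_le_pos (vscale_ge0 (exprn_ge0 n (ltW l0)) (vpos_ge0 _))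
    (orthomorphism_power_le Hpi n (ltW l0) v0).
  rewrite normrZ (ger0_norm (exprn_ge0 n (ltW l0))) => /le_trans/(_ (iterM _)).
  rewrite exprSr -mulrA -ler_pdivlMl ?exprn_gt0// => /le_trans; apply.
  by rewrite expr_div_n mulrCA mulrA.
have : ((fun n => (M / l) ^+ n * (M * `|v|)) @ \oo --> (0 : R))%classic.
  rewrite -[X in _ --> X](mul0r (M * `|v|)); apply: cvgMr_tmp; apply: cvg_expr.
  by rewrite (ger0_norm (divr_ge0 M0 (ltW l0))) ltr_pdivrMr// mul1r.
by move=> cv; apply: (cvgr_to_ge cv); near=> n; exact: xn.
Unshelve. all: by end_near. Qed.

End normed_lattice.

(** * Characters of a normed f-algebra *)

Section multiplication.
Variables (R : realType) (A : fAlgType R).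
Implicit Types (a x y : A) (k : R).

Lemma amul_linearl a k x y : amul a (k *: x + y) = k *: amul a x + amul a y.
Proof. by rewrite amulDr amulZr. Qed.

Lemma amul_linearr a k x y : amul (k *: x + y) a = k *: amul x a + amul y a.
Proof. by rewrite amulDl amulZl. Qed.

Lemma amulNl x y : amul (- x) y = - amul x y.
Proof. by rewrite -scaleN1r amulZl scaleN1r. Qed.

Lemma orthomorphism_amull a : 0 <=v a -> positive_orthomorphism (amul a).
Proof.
move=> a0; split=> [|x x0|x y xy]; first exact: amul_linearl.
  exact: amul_ge0.
by have [] := famulP xy a0.
Qed.

Lemma orthomorphism_amulr a : 0 <=v a -> positive_orthomorphism (amul^~ a).
Proof.
move=> a0; split=> [|x x0|x y xy]; first exact: amul_linearr.
  exact: amul_ge0.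
by have [] := famulP xy a0.
Qed.

Lemma vabs_amul x y : vabs (amul x y) <=v amul (vabs x) (vabs y).
Proof.
have H a b : amul a b <=v amul (vabs a) (vabs b).
  rewrite -[b in amul a b]vposB (vabsE b) !amulDr -scaleN1r amulZr scaleN1r -amulNl.
  apply: vleD; apply: (orthomorphism_le (orthomorphism_amulr (vpos_ge0 _))).
    exact: le_vabs.
  exact: leN_vabs.
by apply/vabs_le; split=> //; rewrite -amulNl -(vabsN x); exact: H.
Qed.

End multiplication.

Section characters.
Variables (R : realType) (A : normedFAlgType R).
Implicit Types (a b c f u v w x y z : A) (k M : R) (phi : A -> R).

Lemma vabs_amul_le a v : vabs (amul a v) <=v `|a| *: vabs v.
Proof.
apply: (vle_trans (vabs_amul a v)); rewrite -norm_vabs.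
apply: (orthomorphism_bound (orthomorphism_amull (vabs_ge0 a))) => //.
  by move=> x; exact: normM_le.
exact: vabs_ge0.
Qed.

Section character.
Variables (u : A) (phi : A -> R).
Hypotheses (u0 : 0 <=v u) (Hphi : lattice_functional u phi) (phiu : phi u = 1).
Let uu := order_ideal_unit u0.
Let LU := lattice_ideal_order u0.

Lemma order_ideal_amul a v : order_ideal u v -> order_ideal u (amul a v).
Proof.
move=> vu; apply: (lattice_idealS LU
  (lattice_idealZ LU (normr_ge0 a) (lattice_ideal_abs LU vu))).
rewrite [X in _ <=v X]vabs_id; first exact: vabs_amul_le.
by apply: vscale_ge0 => //; exact: vabs_ge0.
Qed.

Definition character a := phi (amul a u).

Lemma character_linear k a b :
  character (k *: a + b) = k * character a + character b.
Proof. by rewrite /character amul_linearr (Hphi.1)//; exact: order_ideal_amul. Qed.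

Lemma character_join a b :
  character (vjoin a b) = Num.max (character a) (character b).
Proof.
rewrite /character (orthomorphism_join (orthomorphism_amulr u0)).
by apply: Hphi.2; exact: order_ideal_amul.
Qed.

Lemma characterM a b : character (amul a b) = character a * character b.
Proof.
rewrite /character -amulA.
apply: (functional_eigen u0 Hphi (T := amul a) (M := `|a|)) => //.
- exact: amul_linearl.
- exact: vabs_amul_le.
- exact: order_ideal_amul.
Qed.

Lemma character_le a : `|character a| <= `|a|.
Proof.
rewrite /character -(lattice_functional_abs u0 Hphi); last exact: order_ideal_amul.
rewrite -[X in _ <= X]mulr1 -phiu -(lattice_functionalZ u0 Hphi)//.
apply: (lattice_functional_le u0 Hphi).
- by apply: (lattice_ideal_abs LU); exact: order_ideal_amul.
- exact: (lattice_idealZ LU).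
- by rewrite -{2}(vabs_id u0); exact: vabs_amul_le.
Qed.

End character.

(** The kernel of an orthomorphism is disjoint from its range, because each lattice
functional [phi] is an eigenvector: [phi (pi u) = 0] or [phi f = 0]. *)
Lemma orthomorphism_kernel_disjoint (pi : A -> A) M f v :
  positive_orthomorphism pi -> 0 <= M -> (forall x, `|pi x| <= M * `|x|) ->
  0 <=v f -> 0 <=v v -> pi f = 0 -> f <=v pi v -> f = 0.
Proof.
move=> Hpi M0 piM f0 v0 pif0 fpiv; apply: contrapT => nf0.
pose u := f + v; have u0 : 0 <=v u by exact: vaddr_ge0.
have LU := lattice_ideal_order u0; have uu := order_ideal_unit u0.
have fu : order_ideal u f.
  apply: (lattice_idealS LU uu); rewrite (vabs_id f0) (vabs_id u0).
  exact: vle_addr.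
have vu : order_ideal u v.
  apply: (lattice_idealS LU uu); rewrite (vabs_id v0) (vabs_id u0).
  exact: vle_addl.
have [phi [Hphi phiu phif]] := lattice_functional_separates u0 fu nf0.
have piB x : vabs (pi x) <=v M *: vabs x.
  rewrite -(orthomorphism_abs Hpi); apply: orthomorphism_bound => //.
  exact: vabs_ge0.
have [pilin _ _] := Hpi.
have E := functional_eigen u0 Hphi phiu pilin piB M0.
have piu0 : phi (pi u) = 0.
  have := E _ fu; rewrite pif0 (lattice_functional0 u0 Hphi) => /esym/eqP.
  by rewrite mulf_eq0 => /orP[/eqP//|/eqP].
apply: phif; apply/eqP; rewrite eq_le (lattice_functional_ge0 u0 Hphi fu f0) andbT.
rewrite -[X in _ <= X](mul0r (phi v)) -piu0 -E//.
apply: (lattice_functional_le u0 Hphi) => //.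
apply: (lattice_idealS LU (lattice_idealZ LU M0 vu)).
by apply: (vle_trans (piB v)); rewrite vabsZ ger0_norm//; exact: vle_refl.
Qed.

End characters.

(** * Subalgebras, and generation of the free object *)

Definition lattice_subalgebra (R : realType) (A : vectorLatticeAlgType R)
    (S : set A) :=
  [/\ S 0, forall (k : R) x y, S x -> S y -> S (k *: x + y),
      forall x y, S x -> S y -> S (vjoin x y) &
      forall x y, S x -> S y -> S (amul x y)].

(** The closure proof is a parameter of the type, so that the instances below can
be found from it. *)
Definition subalg (R : realType) (A : normedFAlgType R) (S : set A)
  (SA : lattice_subalgebra S) : Type := {x : A | x \in S}.

Section subalg_instances.
Variables (R : realType) (A : normedFAlgType R) (S : set A).
Hypothesis SA : lattice_subalgebra S.
Local Notation B := (subalg SA).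
Implicit Types (x y z : B) (k : R).

Let ZD k (a b : A) : S a -> S b -> S (k *: a + b).
Proof. by case: SA => _ + _ _; apply. Qed.
Let S0 : S 0. Proof. by case: SA. Qed.
Let SZ k (a : A) : S a -> S (k *: a).
Proof. by move=> Sa; rewrite -[_ *: _]addr0; exact: ZD. Qed.
Let SN (a : A) : S a -> S (- a).
Proof. by rewrite -scaleN1r; exact: SZ. Qed.
Let SD (a b : A) : S a -> S b -> S (a + b).
Proof. by rewrite -{2}(scale1r a); exact: ZD. Qed.
Let SJ (a b : A) : S a -> S b -> S (vjoin a b).
Proof. by case: SA => _ _ + _; apply. Qed.
Let SI (a b : A) : S a -> S b -> S (vmeet a b).
Proof. by move=> Sa Sb; rewrite vmeetE; apply: SD; [exact: SD|exact/SN/SJ]. Qed.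
Let SM (a b : A) : S a -> S b -> S (amul a b). Proof. by case: SA => _ _ _; apply. Qed.

Definition subalg_val x : A := \val x.

Lemma subalg_valP x : S (subalg_val x). Proof. exact/set_mem/(valP x). Qed.

Definition mksubalg (a : A) (Sa : S a) : B := exist _ a (mem_set Sa).

Local Notation v := subalg_val.

Lemma subalg_val_inj : injective subalg_val. Proof. exact: val_inj. Qed.

HB.instance Definition _ := Choice.copy B {x : A | x \in S}.

Definition subalg_zero : B := mksubalg S0.
Definition subalg_opp x : B := mksubalg (SN (subalg_valP x)).
Definition subalg_add x y : B := mksubalg (SD (subalg_valP x) (subalg_valP y)).
Definition subalg_scale k x : B := mksubalg (SZ k (subalg_valP x)).
Definition subalg_join x y : B := mksubalg (SJ (subalg_valP x) (subalg_valP y)).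
Definition subalg_meet x y : B := mksubalg (SI (subalg_valP x) (subalg_valP y)).
Definition subalg_mul x y : B := mksubalg (SM (subalg_valP x) (subalg_valP y)).

Let addA : associative subalg_add.
Proof. by move=> x y z; apply: subalg_val_inj; exact: addrA. Qed.
Let addC : commutative subalg_add.
Proof. by move=> x y; apply: subalg_val_inj; exact: addrC. Qed.
Let add0 : left_id subalg_zero subalg_add.
Proof. by move=> x; apply: subalg_val_inj; exact: add0r. Qed.
Let addN : left_inverse subalg_zero subalg_opp subalg_add.
Proof. by move=> x; apply: subalg_val_inj; exact: addNr. Qed.
HB.instance Definition _ := GRing.isZmodule.Build B addA addC add0 addN.

Let scaleA k l x : subalg_scale k (subalg_scale l x) = subalg_scale (k * l) x.
Proof. by apply: subalg_val_inj; exact: scalerA. Qed.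
Let scale1 : left_id 1 subalg_scale.
Proof. by move=> x; apply: subalg_val_inj; exact: scale1r. Qed.
Let scaleDr : right_distributive subalg_scale +%R.
Proof. by move=> k x y; apply: subalg_val_inj; exact: scalerDr. Qed.
Let scaleDl x : {morph subalg_scale^~ x : k l / k + l}.
Proof. by move=> k l; apply: subalg_val_inj; exact: scalerDl. Qed.
HB.instance Definition _ :=
  GRing.Zmodule_isLmodule.Build R B scaleA scale1 scaleDr scaleDl.

Definition subalg_le x y : Prop := vle (v x) (v y).
Let le_refl x : subalg_le x x. Proof. exact: vle_refl. Qed.
Let le_anti x y : subalg_le x y -> subalg_le y x -> x = y.
Proof. by move=> xy yx; apply: subalg_val_inj; exact: vle_anti. Qed.
Let le_trans y x z : subalg_le x y -> subalg_le y z -> subalg_le x z.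
Proof. exact: vle_trans. Qed.
Let le_meet x y z : subalg_le x (subalg_meet y z) <-> subalg_le x y /\ subalg_le x z.
Proof. exact: vle_meet. Qed.
Let join_le x y z : subalg_le (subalg_join x y) z <-> subalg_le x z /\ subalg_le y z.
Proof. exact: vjoin_le. Qed.
Let leD x y z : subalg_le x y -> subalg_le (x + z) (y + z).
Proof. exact: vleD2r. Qed.
Let scale_ge0 k x : 0 <= k -> subalg_le 0 x -> subalg_le 0 (k *: x).
Proof. exact: vscale_ge0. Qed.
HB.instance Definition _ := Lmodule_isVectorLattice.Build R B
  le_refl le_anti le_trans le_meet join_le leD scale_ge0.

Let mulA : associative subalg_mul.
Proof. by move=> x y z; apply: subalg_val_inj; exact: amulA. Qed.
Let mulDl : left_distributive subalg_mul +%R.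
Proof. by move=> x y z; apply: subalg_val_inj; exact: amulDl. Qed.
Let mulDr : right_distributive subalg_mul +%R.
Proof. by move=> x y z; apply: subalg_val_inj; exact: amulDr. Qed.
Let mulZl k x y : subalg_mul (k *: x) y = k *: subalg_mul x y.
Proof. by apply: subalg_val_inj; exact: amulZl. Qed.
Let mulZr k x y : subalg_mul x (k *: y) = k *: subalg_mul x y.
Proof. by apply: subalg_val_inj; exact: amulZr. Qed.
Let mul_ge0 x y : vle 0 x -> vle 0 y -> vle 0 (subalg_mul x y).
Proof. by move=> x0 y0; exact: (@amul_ge0 R A). Qed.
HB.instance Definition _ := VectorLattice_isAlgebra.Build R B
  mulA mulDl mulDr mulZl mulZr mul_ge0.

Let fmul x y z : vmeet x y = 0 -> vle 0 z ->
  vmeet (amul x z) y = 0 /\ vmeet (amul z x) y = 0.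
Proof.
move=> /(congr1 v) xy z0; have [H1 H2] := @famulP R A _ _ _ xy z0.
by split; apply: subalg_val_inj.
Qed.
HB.instance Definition _ := VectorLatticeAlgebra_isFAlgebra.Build R B fmul.

Definition subalg_norm x : R := `|v x|.
Let normD x y : subalg_norm (x + y) <= subalg_norm x + subalg_norm y.
Proof. exact: ler_normD. Qed.
Let normZ k x : subalg_norm (k *: x) = `|k| * subalg_norm x.
Proof. exact: normrZ. Qed.
Let norm_eq0 x : subalg_norm x = 0 -> x = 0.
Proof. by move=> /normr0_eq0 x0; exact: subalg_val_inj. Qed.
HB.instance Definition _ := Lmodule_isNormed.Build R B normD normZ norm_eq0.

Let norm_lattice x y : vle (vabs x) (vabs y) -> `|x| <= `|y| :> R.
Proof. exact: (@lattice_norm R A). Qed.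
Let norm_mul x y : `|amul x y| <= `|x| * `|y| :> R.
Proof. exact: (@normM_le R A). Qed.
HB.instance Definition _ := FAlgebra_isNormedFAlgebra.Build R B norm_lattice norm_mul.

Lemma subalg_val_hom : lattice_alg_hom (subalg_val : B -> A).
Proof. by split. Qed.

End subalg_instances.

Lemma isometry_contractive (R : realType) (V W : normedModType R) (f : V -> W) :
  (forall x, `|f x| = `|x|) -> contractive f.
Proof. by move=> fE; apply: ge_ereal_sup => _ [x /= x1 <-]; rewrite lee_fin fE. Qed.

Lemma lattice_alg_hom_id (R : realType) (A : vectorLatticeAlgType R) :
  lattice_alg_hom (@id A).
Proof. by split. Qed.

Lemma lattice_alg_hom_comp (R : realType) (A B C : vectorLatticeAlgType R)
    (f : B -> C) (g : A -> B) :
  lattice_alg_hom f -> lattice_alg_hom g -> lattice_alg_hom (f \o g).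
Proof.
move=> [f1 f2 f3 f4] [g1 g2 g3 g4]; split.
- by move=> k x y /=; rewrite g1 f1.
- by move=> x y /=; rewrite g2 f2.
- by move=> x y /=; rewrite g3 f3.
- by move=> x y /=; rewrite g4 f4.
Qed.

(** The extension to [F] of the corestriction of [eta] to the subalgebra, followed
by the inclusion, extends [eta]; by uniqueness it is the identity of [F]. *)
Lemma FNfA_generated (R : realType) (E : normedModType R)
    (F : normedFAlgType R) (eta : {linear E -> F}) (S : set F) :
  is_FNfA eta -> lattice_subalgebra S -> (forall x, S (eta x)) -> S = [set: F].
Proof.
move=> hF SA Seta.
pose T0 x : subalg SA := mksubalg SA (Seta x).
have T0lin : linear T0.
  by move=> k x y; apply: subalg_val_inj; exact: linearP.
pose T : {linear E -> subalg SA} :=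
  HB.pack T0 (GRing.isLinear.Build R E (subalg SA) *:%R T0 T0lin).
have Tcontr : contractive T.
  by apply: isometry_contractive => x; exact: (FNfA_isometry hF x).
have [h [hhom hT _ _]] := FNfA_universal hF Tcontr.
have [g [_ _ _ guniq]] :=
  FNfA_universal hF (isometry_contractive (FNfA_isometry hF)).
have E1 : id = g by apply: guniq; first exact: lattice_alg_hom_id.
have E2 : @subalg_val _ _ _ SA \o h = g.
  apply: guniq; first by apply: lattice_alg_hom_comp => //; exact: subalg_val_hom.
  by apply/funext => x /=; rewrite -[h _]/((h \o eta) x) hT.
apply/seteqP; split=> // f _; rewrite -[f]/(id f) E1 -E2.
exact: subalg_valP.
Qed.

(** * Bounded linear forms on a normed space *)

Section dual.
Variables (R : realType) (E : normedModType R).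
Implicit Types (f g : E -> R) (x y z : E) (k t : R).

Definition bounded_form f :=
  (forall k x y, f (k *: x + y) = k * f x + f y) /\
  exists2 K, 0 <= K & forall x, `|f x| <= K * `|x|.

Lemma bounded_form0 : bounded_form (fun=> 0).
Proof.
by split=> [k x y|]; [rewrite mulr0 addr0|exists 0 => // x; rewrite normr0 mul0r].
Qed.

Lemma bounded_formZD k f g : bounded_form f -> bounded_form g ->
  bounded_form (fun x => k * f x + g x).
Proof.
move=> [flin [K K0 fK]] [glin [L L0 gL]]; split.
  by move=> a x y; rewrite flin glin; ring.
exists (`|k| * K + L) => [|x]; first by rewrite addr_ge0// mulr_ge0.
rewrite mulrDl; apply: (le_trans (ler_normD _ _)); apply: lerD => //.
by rewrite normrM -mulrA ler_wpM2l.
Qed.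

(** Hahn-Banach: extend to a total cone the cone generated by the ball of radius
[`|z| / 2] around [z].  The functional is bounded because it is nonnegative on
that ball. *)
Lemma bounded_form_separates z : z != 0 -> exists2 f, bounded_form f & f z != 0.
Proof.
move=> z0; have nz : 0 < `|z| by rewrite normr_gt0.
pose C := [set v | exists2 t, 0 <= t & `|v - t *: z| <= t * (`|z| / 2)].
have C0 : C 0 by exists 0 => //; rewrite scale0r subrr normr0 mul0r.
have coneC : convex_cone C.
  move=> a b v w a0 b0 [t t0 vt] [r r0 wr]; exists (a * t + b * r).
    by rewrite addr_ge0// mulr_ge0.
  rewrite scalerDl -!scalerA opprD addrACA -!scalerBr.
  apply: (le_trans (ler_normD _ _)); rewrite !normrZ !ger0_norm// [leRHS]mulrDl.
  by rewrite -!mulrA lerD// ler_wpM2l.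
have nCz : ~ C (- z).
  move=> [t t0]; rewrite -scaleN1r -scalerBl normrZ -opprD normrN ger0_norm ?addr_ge0//.
  by nra.
have [M [CM coneM totM nMz]] := total_cone_exists C0 coneC nCz.
have [f [flin f0 fz]] := total_cone_functional coneM totM nMz.
(* With t = 2 |v| / |z| the ball of radius t |z| / 2 has radius |v|. *)
have Cv v : C ((2 / `|z| * `|v|) *: z + v).
  have t0 : 0 <= 2 / `|z| * `|v| by rewrite mulr_ge0// divr_ge0.
  exists (2 / `|z| * `|v|) => //; rewrite [_ + v]addrC addrK.
  have -> : 2 / `|z| * `|v| * (`|z| / 2) = `|v| by field; rewrite gt_eqF.
  by [].
have bnd v : cone_bounded M z v.
  exists (2 / `|z| * `|v|); split; apply: CM; last exact: Cv.
  by have := Cv (- v); rewrite normrN.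
exists f; last by rewrite fz oner_eq0.
split=> [k x y|]; first exact: flin.
exists (2 / `|z|) => [|x]; first by rewrite divr_ge0.
have le v : - f v <= 2 / `|z| * `|v|.
  have := f0 _ (bnd _) (CM _ (Cv v)); rewrite flin // fz mulr1.
  by lra.
rewrite ler_norml -lerN2 opprK le /=.
have fN : f (- x) = - f x.
  have f00 : f 0 = 0 by have := flin 1 0 0 (bnd _) (bnd _); rewrite scaler0 addr0; lra.
  by rewrite -scaleN1r -[_ *: _]addr0 flin// mulN1r f00 addr0.
by have := le (- x); rewrite fN opprK normrN.
Qed.

Definition subspace (L : set E) :=
  L 0 /\ forall k x y, L x -> L y -> L (k *: x + y).

(** Membership in the span of [s] is expressed as membership in every subspace that
contains [s], which needs no coordinates.  In the inductive step a form that
vanishes on [s] but not on [y] is used to project along [y]. *)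
Lemma span_or_separate (s : seq E) x :
  (forall L, subspace L -> (forall y, y \in s -> L y) -> L x) \/
  exists f, [/\ bounded_form f, forall y, y \in s -> f y = 0 & f x != 0].
Proof.
elim: s x => [|y s IH] x.
  have [->|x0] := eqVneq x 0; first by left=> L [L0 _] _.
  by right; have [f ff fx] := bounded_form_separates x0; exists f.
have mem_tl w : w \in s -> w \in y :: s by rewrite inE => ->; rewrite orbT.
have [ys|[f [ff fs fy]]] := IH y.
  have [xs|[g [gg gs gx]]] := IH x.
    by left=> L HL Ls; apply: xs => // w /mem_tl; exact: Ls.
  right; exists g; split=> // w; rewrite inE => /predU1P[->|]; last exact: gs.
  apply: (ys [set w | g w = 0]) => //; split=> /=.
    by have := gg.1 1 0 0; rewrite scaler0 addr0; lra.
  by move=> k a b; rewrite gg.1 => -> ->; rewrite mulr0 addr0.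
(* The projection of [x] along [y] onto the kernel of [f]. *)
have [xs|[g [gg gs gx]]] := IH (- (f x / f y) *: y + x).
  left=> L HL Ls.
  have -> : x = (f x / f y) *: y + (- (f x / f y) *: y + x).
    by rewrite addrA -scalerDl subrr scale0r add0r.
  have [L0 LD] := HL; apply: LD; first by apply: Ls; rewrite mem_head.
  by apply: xs => // w /mem_tl; exact: Ls.
right; exists (fun w => - (g y / f y) * f w + g w); split.
- exact: bounded_formZD.
- move=> w; rewrite inE => /predU1P[->|ws]; first by rewrite mulNr divfK// addNr.
  by rewrite (fs w ws) (gs w ws) mulr0 addr0.
- have -> : - (g y / f y) * f x + g x = g (- (f x / f y) *: y + x).
    by rewrite gg.1; ring.
  by [].
Qed.

(** By induction: if the next vector is in the span of the previous ones, the form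
already agrees with [psi] there by linearity; otherwise it is corrected by a
multiple of a form that vanishes on the previous ones. *)
Lemma bounded_form_interpolates (D : set E) (psi : E -> R) (s : seq E) :
  subspace D ->
  (forall k x y, D x -> D y -> psi (k *: x + y) = k * psi x + psi y) ->
  (forall x, x \in s -> D x) ->
  exists2 f, bounded_form f & forall x, x \in s -> f x = psi x.
Proof.
move=> [D0 DD] psilin; elim: s => [|x s IH] sD.
  by exists (fun=> 0) => //; exact: bounded_form0.
have mem_tl w : w \in s -> w \in x :: s by rewrite inE => ->; rewrite orbT.
have Dx : D x by apply: sD; rewrite mem_head.
have [w /mem_tl/sD//|f ff fs] := IH.
have [xs|[g [gg gs gx]]] := span_or_separate s x.
  exists f => // w; rewrite inE => /predU1P[->|]; last exact: fs.
  have [] : (D `&` [set w | f w = psi w]) x; last by [].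
  apply: xs => [|y ys]; last by split; [exact/sD/mem_tl|exact: fs].
  split.
    split=> //=; have := ff.1 1 0 0; have := psilin 1 _ _ D0 D0.
    by rewrite scaler0 addr0; lra.
  move=> k a b [Da fa] [Db fb]; split; first exact: DD.
  by rewrite /= ff.1 psilin// fa fb.
exists (fun w => ((psi x - f x) / g x) * g w + f w); first exact: bounded_formZD.
move=> w; rewrite inE => /predU1P[->|ws]; first by rewrite divfK// subrK.
by rewrite (gs w ws) mulr0 add0r fs.
Qed.

End dual.

(** * Evaluation on the dual ball *)

Section evaluation.
Variables (R : realType) (E : normedModType R).

Lemma eval_continuous (x : E) : continuous (fun xs : dual_ball E => set_val xs x : R).
Proof.
move=> xs; apply: (@continuous_comp _ _ _ set_val (fun f : {ptws E -> R} => f x)).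
  exact: initial_continuous.
exact: (@proj_continuous E (fun=> R) x).
Qed.

Definition eval (x : E) : C_dual_ball E :=
  mkcontfun (@compact_weakstar_ball R E) (@eval_continuous x).

Lemma dual_ball_val (xs : dual_ball E) :
  linear (set_val xs : E -> R^o) /\ forall x, `|set_val xs x : R| <= `|x|.
Proof. exact/dual_ballP/set_valP. Qed.

Lemma eval_linear : linear eval.
Proof.
by move=> k x y; apply: contfun_eq => xs; have [+ _] := dual_ball_val xs; apply.
Qed.

HB.instance Definition _ :=
  GRing.isLinear.Build R E (C_dual_ball E) *:%R eval eval_linear.

Lemma eval_contractive : contractive eval.
Proof.
apply: ge_ereal_sup => _ [x /= x1 <-]; rewrite lee_fin; apply: le_trans x1.
by apply: sup_norm_le => // xs; have [_] := dual_ball_val xs; apply.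
Qed.

Lemma dual_ball_mk (f : E -> R) :
  (forall k x y, f (k *: x + y) = k * f x + f y) ->
  (forall x, `|f x| <= `|x|) -> exists xs : dual_ball E, set_val xs = f.
Proof.
move=> flin fx; have Bf : dual_ball E f by apply/dual_ballP; split.
by exists (exist _ f (mem_set Bf)).
Qed.

End evaluation.

(** * Injectivity of the embedding *)

Lemma quadratic_le0 (R : realType) (a C : R) : 0 <= C ->
  (forall t, 0 < t -> t <= 1 -> t * `|a| <= C * t ^+ 2) -> a = 0.
Proof.
move=> C0 H; apply: contrapT => /eqP; rewrite -normr_gt0 => a0.
pose t := `|a| / (`|a| + C + 1).
have d0 : 0 < `|a| + C + 1 by lra.
have t0 : 0 < t by rewrite divr_gt0.
have t1 : t <= 1 by rewrite ler_pdivrMr//; lra.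
have := H t t0 t1; rewrite expr2 mulrCA ler_pM2l//.
rewrite /t mulrA ler_pdivlMr// [C * _]mulrC ler_pM2l//; lra.
Qed.

Section embedding.
Variables (R : realType) (E : normedModType R) (F : normedFAlgType R)
  (eta : {linear E -> F}) (hF : is_FNfA eta) (iota : F -> C_dual_ball E).
Hypotheses (iota_hom : lattice_alg_hom iota)
  (iota_eta : forall x (xs : dual_ball E), iota (eta x) xs = set_val xs x).
Implicit Types (f g b c u : F) (x : E) (xs ys : dual_ball E) (k t : R).

Let iota_lin xs k f g : iota (k *: f + g) xs = k * iota f xs + iota g xs.
Proof. by have [-> _ _ _] := iota_hom. Qed.

Let iota_join xs f g : iota (vjoin f g) xs = Num.max (iota f xs) (iota g xs).
Proof. by have [_ _ -> _] := iota_hom. Qed.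

Let iota_mul xs f g : iota (amul f g) xs = iota f xs * iota g xs.
Proof. by have [_ _ _ ->] := iota_hom. Qed.

Let iota0 xs : iota 0 xs = 0.
Proof. by have := iota_lin xs 1 0 0; rewrite scaler0 addr0; lra. Qed.

(** Both sides are homomorphisms, and the point [xs] is the restriction of the
character to the generators. *)
Lemma character_eval u (phi : F -> R) : 0 <=v u -> lattice_functional u phi ->
  phi u = 1 -> exists xs, forall f, iota f xs = character u phi f.
Proof.
move=> u0 Hphi phiu.
have [||xs xsE] := @dual_ball_mk R E (fun x => character u phi (eta x)).
- by move=> k x y; rewrite linearP character_linear.
- move=> x; rewrite -(FNfA_isometry hF x); exact: character_le.
exists xs => f; pose S := [set f | iota f xs = character u phi f].
suff : [set: F] f -> S f by exact.
rewrite -(@FNfA_generated _ _ _ _ S hF)//.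
  split.
  - rewrite /S /= iota0.
    by have := character_linear u0 Hphi 1 0 0; rewrite scaler0 addr0; lra.
  - by move=> k g h; rewrite /S /= iota_lin character_linear// => -> ->.
  - by move=> g h; rewrite /S /= iota_join character_join// => -> ->.
  - by move=> g h; rewrite /S /= iota_mul characterM// => -> ->.
by move=> x; rewrite /S /= iota_eta xsE.
Qed.

Lemma iota_kernel_annihilates f u : (forall xs, iota f xs = 0) -> 0 <=v u ->
  amul f u = 0.
Proof.
move=> f0 u0; apply: contrapT => fu0.
have fu : order_ideal u (amul f u).
  by apply: (order_ideal_amul u0); exact: order_ideal_unit.
have [phi [Hphi phiu]] := lattice_functional_separates u0 fu fu0; apply.
have [xs xsE] := character_eval u0 Hphi phiu.
by rewrite -[phi _]/(character u phi f) -xsE.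
Qed.

(** [g] is the derivative of [f] at the origin: if the functional [phi] on a
principal ideal containing the generators in [s] is, on these generators,
evaluation at the point [xs] of the dual ball, then [iota f] and [t * phi g]
agree to second order at [t xs], which is called [ys]. *)
Definition linear_part f g (s : seq E) :=
  forall u (phi : F -> R), 0 <=v u -> lattice_functional u phi ->
  (forall x, x \in s -> order_ideal u (eta x)) ->
  order_ideal u g /\
  forall xs, (forall x, x \in s -> set_val xs x = phi (eta x)) ->
  exists2 C : R, 0 <= C & forall t ys, 0 <= t -> t <= 1 ->
    (forall x, set_val ys x = t * set_val xs x) ->
    `|iota f ys - t * phi g| <= C * t ^+ 2.

Definition linearizable f := exists g b c s,
  [/\ 0 <=v b, 0 <=v c, vabs (f - g) <=v amul b c & linear_part f g s].

Lemma linear_part_catl f g s s' : linear_part f g s -> linear_part f g (s ++ s').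
Proof.
move=> H u phi u0 Hphi su; have [x xs|gu H'] := H _ _ u0 Hphi.
  by apply: su; rewrite mem_cat xs.
by split=> // xs xsE; apply: H' => x xS; apply: xsE; rewrite mem_cat xS.
Qed.

Lemma linear_part_catr f g s s' : linear_part f g s -> linear_part f g (s' ++ s).
Proof.
move=> H u phi u0 Hphi su; have [x xs|gu H'] := H _ _ u0 Hphi.
  by apply: su; rewrite mem_cat xs orbT.
by split=> // xs xsE; apply: H' => x xS; apply: xsE; rewrite mem_cat xS orbT.
Qed.

Lemma linear_partZD k f g f' g' s : linear_part f g s -> linear_part f' g' s ->
  linear_part (k *: f + f') (k *: g + g') s.
Proof.
move=> H H' u phi u0 Hphi su.
have [gu Hg] := H _ _ u0 Hphi su; have [gu' Hg'] := H' _ _ u0 Hphi su.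
split=> [|xs xsE]; first exact: order_idealZD.
have [C C0 HC] := Hg _ xsE; have [C' C'0 HC'] := Hg' _ xsE.
exists (`|k| * C + C') => [|t ys t0 t1 ysE]; first by rewrite addr_ge0// mulr_ge0.
rewrite iota_lin (Hphi.1)//.
have -> : k * iota f ys + iota f' ys - t * (k * phi g + phi g') =
  k * (iota f ys - t * phi g) + (iota f' ys - t * phi g') by ring.
apply: (le_trans (ler_normD _ _)); rewrite mulrDl lerD//; last exact: HC'.
by rewrite normrM -mulrA ler_wpM2l//; exact: HC.
Qed.

Lemma linear_part_join f g f' g' s : linear_part f g s -> linear_part f' g' s ->
  linear_part (vjoin f f') (vjoin g g') s.
Proof.
move=> H H' u phi u0 Hphi su.
have [gu Hg] := H _ _ u0 Hphi su; have [gu' Hg'] := H' _ _ u0 Hphi su.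
split=> [|xs xsE]; first exact: order_ideal_join.
have [C C0 HC] := Hg _ xsE; have [C' C'0 HC'] := Hg' _ xsE.
exists (C + C') => [|t ys t0 t1 ysE]; first by rewrite addr_ge0.
rewrite iota_join (Hphi.2)// maxr_pMr// mulrDl.
have := HC _ _ t0 t1 ysE; have := HC' _ _ t0 t1 ysE.
move: (iota f ys) (iota f' ys) (t * phi g) (t * phi g') (C * _) (C' * _).
move=> p q p' q' d d'; rewrite !ler_norml => /andP[? ?] /andP[? ?].
by rewrite /Num.max; case: ifP => ?; case: ifP => ?; lra.
Qed.

(** Both factors are of first order, so the product has derivative [0]. *)
Lemma linear_partM f g f' g' s : linear_part f g s -> linear_part f' g' s ->
  linear_part (amul f f') 0 s.
Proof.
move=> H H' u phi u0 Hphi su.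
have [gu Hg] := H _ _ u0 Hphi su; have [gu' Hg'] := H' _ _ u0 Hphi su.
split=> [|xs xsE]; first exact: order_ideal0.
have [C C0 HC] := Hg _ xsE; have [C' C'0 HC'] := Hg' _ xsE.
exists ((C + `|phi g|) * (C' + `|phi g'|)) => [|t ys t0 t1 ysE].
  by rewrite mulr_ge0// addr_ge0.
rewrite iota_mul (lattice_functional0 u0 Hphi) mulr0 subr0 normrM.
have le (p q d : R) : 0 <= d -> `|p - t * q| <= d * t ^+ 2 -> `|p| <= t * (d + `|q|).
  move=> d0 H1; rewrite -[p](subrK (t * q)).
  apply: (le_trans (ler_normD _ _)).
  rewrite mulrDr normrM (ger0_norm t0) lerD// (le_trans H1)// expr2 mulrCA.
  by rewrite ler_wpM2l// ler_piMr.
have -> : (C + `|phi g|) * (C' + `|phi g'|) * t ^+ 2 =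
  (t * (C + `|phi g|)) * (t * (C' + `|phi g'|)) by ring.
by apply: ler_pM => //; apply: le => //; [exact: HC|exact: HC'].
Qed.

(** The linearizable elements form a subalgebra containing the generators; the
bounds add up because [b c + b' c' <= (b + b') (c + c')] for positive elements. *)
Lemma linearizable_all f : linearizable f.
Proof.
suff : [set: F] f -> [set f | linearizable f] f by exact.
rewrite -(@FNfA_generated _ _ _ _ [set f | linearizable f] hF)//.
  have le0 : vle (0 : F) 0 := vle_refl 0.
  have mulD (b c b' c' : F) : 0 <=v b -> 0 <=v c -> 0 <=v b' -> 0 <=v c' ->
      amul b c + amul b' c' <=v amul (b + b') (c + c').
    move=> b0 c0 b'0 c'0; rewrite amulDl !amulDr; apply: vleD.
      by apply: vle_addr; exact: amul_ge0.
    by apply: vle_addl; exact: amul_ge0.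
  split=> /=.
  - exists 0, 0, 0, [::]; split=> //.
      by rewrite subr0 (vabs_id le0); exact: amul_ge0.
    move=> u phi u0 Hphi _; split=> [|xs _]; first exact: order_ideal0.
    exists 0 => // t ys _ _ _.
    by rewrite iota0 (lattice_functional0 u0 Hphi) mulr0 subr0 normr0 mul0r.
  - move=> k h h' [g [b [c [s [b0 c0 hg L]]]]] [g' [b' [c' [s' [b'0 c'0 hg' L']]]]].
    exists (k *: g + g'), (`|k| *: b + b'), (c + c'), (s ++ s'); split.
    + by apply: vaddr_ge0 => //; exact: vscale_ge0.
    + exact: vaddr_ge0.
    + rewrite opprD addrACA -scalerBr; apply: (vle_trans (vabsD _ _)).
      have kb0 : 0 <=v `|k| *: b by exact: vscale_ge0.
      apply: vle_trans (mulD _ _ _ _ kb0 c0 b'0 c'0); apply: vleD => //.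
      by rewrite vabsZ amulZl; exact: vscale_le.
    + by apply: linear_partZD; [exact: linear_part_catl|exact: linear_part_catr].
  - move=> h h' [g [b [c [s [b0 c0 hg L]]]]] [g' [b' [c' [s' [b'0 c'0 hg' L']]]]].
    exists (vjoin g g'), (b + b'), (c + c'), (s ++ s'); split.
    + exact: vaddr_ge0.
    + exact: vaddr_ge0.
    + apply: (vle_trans (vabs_join _ _ _ _)).
      by apply: vle_trans (mulD _ _ _ _ b0 c0 b'0 c'0); exact: vleD.
    + by apply: linear_part_join; [exact: linear_part_catl|exact: linear_part_catr].
  - move=> h h' [g [b [c [s [b0 c0 hg L]]]]] [g' [b' [c' [s' [b'0 c'0 hg' L']]]]].
    exists 0, (vabs h), (vabs h'), (s ++ s'); split; try exact: vabs_ge0.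
    + by rewrite subr0; exact: vabs_amul.
    + by apply: (@linear_partM _ g _ g');
        [exact: linear_part_catl|exact: linear_part_catr].
move=> x /=; exists (eta x), 0, 0, [:: x]; split; try exact: vle_refl.
  by rewrite subrr (vabs_id (vle_refl 0)); apply: amul_ge0; exact: vle_refl.
move=> u phi u0 Hphi su; have xs1 : x \in [:: x] by rewrite inE.
split=> [|xs xsE]; first exact: su.
exists 0 => // t ys _ _ ysE.
by rewrite iota_eta ysE xsE// subrr normr0 mul0r.
Qed.

Lemma common_bound (s : seq E) :
  exists2 u, 0 <=v u & forall x, x \in s -> order_ideal u (eta x).
Proof.
elim: s => [|x s [u u0 su]]; first by exists 0 => //; exact: vle_refl.
have xu0 : 0 <=v vabs (eta x) + u by apply: vaddr_ge0 => //; exact: vabs_ge0.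
exists (vabs (eta x) + u) => // y; rewrite inE => /predU1P[->|ys].
  by exists 1 => //; rewrite scale1r; exact: vle_addr.
have [k k0 yk] := su y ys; exists k => //; apply: (vle_trans yk).
by apply: vscale_le => //; apply: vle_addl; exact: vabs_ge0.
Qed.

(** If [g] were not zero, some [phi] would not vanish at [g].  On the finite set
[s] it agrees with a bounded form, which becomes a point of the dual ball after
rescaling [phi]; then [t |phi g| <= C t^2] for small [t]. *)
Lemma linear_part_kernel f g s : linear_part f g s -> (forall xs, iota f xs = 0) ->
  g = 0.
Proof.
move=> L f0; apply: contrapT => g0.
have [u u0 su] := common_bound s.
have gu : order_ideal u g.
  (* That [g] is in the ideal can be read off from the zero functional. *)
  have z : lattice_functional u (fun=> 0 : R).
    by split=> [a x y|x y]; rewrite ?mulr0 ?addr0 ?maxxx.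
  by have [] := L _ _ u0 z su.
have [phi [Hphi phiu phig]] := lattice_functional_separates u0 gu g0.
have [|||f1 [f1lin [K K0 f1K]] f1s] := @bounded_form_interpolates R E
  [set x | order_ideal u (eta x)] (phi \o eta) s.
- split=> /= [|k x y xu yu]; first by rewrite linear0; exact: order_ideal0.
  by rewrite linearP; exact: order_idealZD.
- by move=> k x y xu yu /=; rewrite linearP (Hphi.1).
- by [].
(* The rescaled form [c * f1] is in the dual ball; [K + 1] avoids [K = 0]. *)
pose c := (K + 1)^-1.
have K1 : 0 < K + 1 by lra.
have c0 : 0 < c by rewrite invr_gt0.
have ball t : 0 <= t -> t <= 1 ->
    exists ys : dual_ball E, set_val ys = (fun x => t * (c * f1 x)) :> (E -> R).
  move=> t0 t1; apply: dual_ball_mk => [k x y|x]; first by rewrite f1lin; ring.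
  rewrite !normrM (ger0_norm t0) (gtr0_norm c0); apply: (@le_trans _ _ (c * `|f1 x|)).
    by rewrite ler_piMl// mulr_ge0// ltW.
  rewrite /c mulrC ler_pdivrMr//; apply: (le_trans (f1K x)).
  by rewrite mulrC ler_wpM2l//; lra.
have [xs xsE] := ball 1 ler01 (lexx 1).
have [_ H] := L _ _ u0 (lattice_functionalZl (ltW c0) Hphi) su.
have [x xS|C C0 HC] := H xs; first by rewrite xsE mul1r f1s.
apply: phig; suff : c * phi g = 0.
  by move=> /eqP; rewrite mulf_eq0 gt_eqF//= => /eqP.
apply: (quadratic_le0 C0) => t t0 t1.
have [ys ysE] := ball t (ltW t0) t1.
have := HC t ys (ltW t0) t1; rewrite f0 sub0r normrN normrM gtr0_norm//; apply.
by move=> x; rewrite ysE xsE mul1r.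
Qed.

(** [|f|] is killed by right multiplication by [c], and dominated by [amul b c],
which is in the range of that multiplication. *)
Lemma iota_kernel f : (forall xs, iota f xs = 0) -> f = 0.
Proof.
move=> f0; have [g [b [c [s [b0 c0 + L]]]]] := linearizable_all f.
rewrite (linear_part_kernel L f0) subr0 => fbc.
have Hc := orthomorphism_amulr c0.
apply: vabs_eq0; apply: (orthomorphism_kernel_disjoint Hc (normr_ge0 c) _ _ b0).
- by move=> x; rewrite mulrC; exact: normM_le.
- exact: vabs_ge0.
- rewrite (orthomorphism_abs Hc) iota_kernel_annihilates//.
  by rewrite vabs_id//; exact: vle_refl.
- exact: fbc.
Qed.

Lemma iota_injective : injective iota.
Proof.
move=> f g fg; apply/eqP; rewrite -subr_eq0; apply/eqP/iota_kernel => xs.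
by rewrite -scaleN1r addrC iota_lin fg mulN1r addNr.
Qed.

End embedding.

Theorem corollary4p11 (R : realType) (E : completeNormedModType R)
    (F : normedFAlgType R) (eta : {linear E -> F}) (hF : is_FNfA eta) :
  exists! iota : F -> C_dual_ball E,
    [/\ lattice_alg_hom iota, injective iota, contractive iota &
        forall (x : E) (xs : dual_ball E), iota (eta x) xs = set_val xs x].
Proof.
have [iota [ihom iT inorm iuniq]] := FNfA_universal hF (@eval_contractive R E).
have iotaE x (xs : dual_ball E) : iota (eta x) xs = set_val xs x.
  by rewrite -[iota _]/((iota \o eta) x) iT.
exists iota; split.
  split=> //; first exact: (iota_injective hF ihom iotaE).
  by rewrite /contractive inorm; exact: eval_contractive.
move=> h [hhom _ _ hE]; apply/esym/iuniq => //.
by apply/funext => x; apply: contfun_eq => xs; rewrite /= hE.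
Qed.
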